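(* Let $p$ be a prime and let $L/K$ be a ramified Galois extension of degree $p$ of $p$-adic fields, with ramification jump $t$. Suppose that $t\equiv 0\pmod p$. Then $L=K(\pi_K^{1/p})$ for a suitable uniformiser $\pi_K$ of $K$, we have $m(L/K)=p^{\frac{1}{2}[L:\mathbb{Q}_p]}$, and an element $\omega=\sum_{i=0}^{p-1}c_i\pi_K^{i/p}$ (with $c_0,\ldots,c_{p-1}\in\mathcal{O}_K$) achieves the minimal index, that is, $[\mathcal{O}_L:\mathcal{O}_K[G]\omega]=m(L/K)$ where $G=\operatorname{Gal}(L/K)$, if and only if every $c_i$ is a unit in $\mathcal{O}_K$.
   Context: A $p$-adic field is a finite extension of $\mathbb{Q}_p$. For a Galois extension $L/K$ of $p$-adic fields with Galois group $G$, the minimal index is $m(L/K):=\min_{\alpha\in\mathcal{O}_L}[\mathcal{O}_L:\mathcal{O}_K[G]\alpha]$, where the index is that of additive groups and $\mathcal{O}_K[G]$ acts naturally on the ring of integers $\mathcal{O}_L$. The lower ramification groups are $G_i=\{g\in G:(g-1)(\mathcal{O}_L)\subseteq(\pi_L)^{i+1}\}$ for $i\ge-1$, with $\pi_L$ a uniformiser of $L$; a ramification jump is an integer $t$ with $G_t\neq G_{t+1}$, and a ramified Galois extension of degree $p$ has exactly one. Here $\pi_K^{1/p}\in L$ is a fixed $p$-th root of $\pi_K$ and $\pi_K^{i/p}=(\pi_K^{1/p})^i$. *)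

(* Defs.v *)
From HB Require Import structures.
From mathcomp Require Import all_boot all_order all_fingroup all_algebra all_field.
From mathcomp Require Import all_classical all_reals all_analysis.

Set Implicit Arguments.
Unset Strict Implicit.
Unset Printing Implicit Defensive.

Import Order.TTheory GRing.Theory Num.Theory.
Local Open Scope classical_set_scope.
Local Open Scope ring_scope.

(* Z_p as the inverse limit of the Z/p^n: the n-th entry is the representative
   in {0, ..., p^n - 1}, which the single equation below forces. *)
Definition coherent (p : nat) (x : nat -> int) : Prop :=
  forall n, (x n.+1 %% (p ^ n)%N%:Z)%Z = x n.

Record padic_int (p : nat) (p_pr : prime p) := PadicInt {
  residue :> nat -> int;
  residueP : coherent p residue }.

Section PadicIntRing.
Variables (p : nat) (p_pr : prime p).
Local Notation Zp := (padic_int p_pr).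
Local Notation q n := ((p ^ n)%N%:Z).

Lemma padic_intP (x y : Zp) : x =1 y -> x = y.
Proof.
case: x y => [x xP] [y yP] /= /funext exy; rewrite -{y}exy in yP *.
by rewrite (Prop_irrelevance xP yP).
Qed.

HB.instance Definition _ := gen_eqMixin Zp.
HB.instance Definition _ := gen_choiceMixin Zp.

Lemma modz_tower (a : int) n : ((a %% q n.+1)%Z %% q n)%Z = (a %% q n)%Z.
Proof.
rewrite [in RHS](divz_eq a (q n.+1)) expnS PoszM mulrA.
by rewrite modzMDl -PoszM -expnS.
Qed.

Lemma residue_mod (x : Zp) n : (x n %% q n)%Z = x n.
Proof. by rewrite -(residueP x n) modz_mod. Qed.

Lemma coherent_mod (f : nat -> int) :
    (forall n, (f n.+1 %% q n)%Z = (f n %% q n)%Z) ->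
  coherent p (fun n => (f n %% q n)%Z).
Proof. by move=> fP n; rewrite modz_tower fP. Qed.

Definition padic_of (f : nat -> int)
    (fP : forall n, (f n.+1 %% q n)%Z = (f n %% q n)%Z) : Zp :=
  PadicInt p_pr (coherent_mod fP).

Fact padic_int_subproof (a : int) n : (a %% q n = a %% q n)%Z.
Proof. by []. Qed.
Definition padic_of_int (a : int) : Zp :=
  @padic_of (fun=> a) (padic_int_subproof a).

Fact padic_add_subproof (x y : Zp) n :
  ((x n.+1 + y n.+1) %% q n = (x n + y n) %% q n)%Z.
Proof. by rewrite -modzDm !residueP. Qed.
Definition padic_add (x y : Zp) : Zp := padic_of (padic_add_subproof x y).

Fact padic_opp_subproof (x : Zp) n : ((- x n.+1) %% q n = (- x n) %% q n)%Z.
Proof. by rewrite -modzNm residueP. Qed.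
Definition padic_opp (x : Zp) : Zp := padic_of (padic_opp_subproof x).

Fact padic_mul_subproof (x y : Zp) n :
  ((x n.+1 * y n.+1) %% q n = (x n * y n) %% q n)%Z.
Proof. by rewrite -modzMm !residueP. Qed.
Definition padic_mul (x y : Zp) : Zp := padic_of (padic_mul_subproof x y).

Fact padic_addA : associative padic_add.
Proof.
by move=> x y z; apply: padic_intP => n /=; rewrite modzDmr modzDml addrA.
Qed.
Fact padic_addC : commutative padic_add.
Proof. by move=> x y; apply: padic_intP => n /=; rewrite addrC. Qed.
Fact padic_add0 : left_id (padic_of_int 0) padic_add.
Proof.
by move=> x; apply: padic_intP => n /=; rewrite modzDml add0r residue_mod.
Qed.
Fact padic_addN : left_inverse (padic_of_int 0) padic_opp padic_add.
Proof. by move=> x; apply: padic_intP => n /=; rewrite modzDml addNr. Qed.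

HB.instance Definition _ :=
  GRing.isZmodule.Build Zp padic_addA padic_addC padic_add0 padic_addN.

Fact padic_mulA : associative padic_mul.
Proof.
by move=> x y z; apply: padic_intP => n /=; rewrite modzMmr modzMml mulrA.
Qed.
Fact padic_mulC : commutative padic_mul.
Proof. by move=> x y; apply: padic_intP => n /=; rewrite mulrC. Qed.
Fact padic_mul1 : left_id (padic_of_int 1) padic_mul.
Proof.
by move=> x; apply: padic_intP => n /=; rewrite modzMml mul1r residue_mod.
Qed.
Fact padic_mulDl : left_distributive padic_mul padic_add.
Proof.
by move=> x y z; apply: padic_intP => n /=; rewrite modzMml modzDm mulrDl.
Qed.
Fact padic_1neq0 : padic_of_int 1 != 0.
Proof.
apply/eqP => /(congr1 (fun x : Zp => x 1%N)) /= /eqP.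
rewrite expn1 mod0z modz_small //; apply/andP; split=> //.
by rewrite ltz_nat prime_gt1.
Qed.

HB.instance Definition _ := GRing.Zmodule_isComNzRing.Build Zp
  padic_mulA padic_mulC padic_mul1 padic_mulDl padic_1neq0.

Definition padic_unit : {pred Zp} := fun x => `[< exists y, y * x = 1 >].
Definition padic_inv (x : Zp) : Zp :=
  if pselect (exists y, y * x = 1) is left h then projT1 (cid h) else x.

Fact padic_mulVx : {in padic_unit, left_inverse 1 padic_inv *%R}.
Proof.
move=> x /asboolP xU; rewrite /padic_inv; case: pselect => // h.
by case: cid.
Qed.
Fact padic_unitPl (x y : Zp) : y * x = 1 -> padic_unit x.
Proof. by move=> yx1; apply/asboolP; exists y. Qed.
Fact padic_invr_out : {in [predC padic_unit], padic_inv =1 id}.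
Proof.
move=> x /negP xU; rewrite /padic_inv; case: pselect => // h.
by case: xU; apply/asboolP.
Qed.

HB.instance Definition _ := GRing.ComNzRing_hasMulInverse.Build Zp
  padic_mulVx padic_unitPl padic_invr_out.

Lemma residue_modn (x : Zp) m n : (x (m + n)%N %% q n)%Z = x n.
Proof.
elim: m => [|m IHm]; first exact: residue_mod.
rewrite -{}IHm -[in RHS](residueP x (m + n)) addSn.
rewrite [in LHS](divz_eq (x _) (q (m + n))) expnD PoszM mulrA.
by rewrite modzMDl -PoszM -expnD.
Qed.

Fact padic_idomain : GRing.integral_domain_axiom Zp.
Proof.
have nz (z : Zp) : z != 0 -> exists n, z n != 0.
  move/eqP=> z0; apply: contrapT => nzP; apply: z0; apply: padic_intP => n /=.
  by rewrite mod0z; apply/eqP; apply: contra_notT nzP => ?; exists n.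
move=> x y xy0; apply/norP => -[/nz[i xi] /nz[j yj]].
pose a := `|x (i + j)%N|%N; pose b := `|y (i + j)%N|%N.
have pa : ~~ (p ^ i %| a)%N.
  apply: contra xi; rewrite -(residue_modn x j) addnC => pa.
  by apply/eqP/dvdz_mod0P; rewrite dvdzE absz_nat.
have pb : ~~ (p ^ j %| b)%N.
  apply: contra yj; rewrite -(residue_modn y i) => pb.
  by apply/eqP/dvdz_mod0P; rewrite dvdzE absz_nat.
have a0 : (0 < a)%N by case: (posnP a) pa => // ->; rewrite dvdn0.
have b0 : (0 < b)%N by case: (posnP b) pb => // ->; rewrite dvdn0.
have pab : (p ^ (i + j) %| a * b)%N.
  rewrite /a /b -abszM -[X in (X %| _)%N]absz_nat -dvdzE; apply/dvdz_mod0P.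
  by move/(congr1 (fun z : Zp => z (i + j)%N)): xy0 => /=; rewrite mod0z.
move: pa pb pab; rewrite !pfactor_dvdn ?muln_gt0 ?a0 // lognM // -!ltnNge.
move=> ia jb; apply/negP; rewrite -ltnNge -addSn.
by apply: leq_add => //; apply: ltnW.
Qed.

HB.instance Definition _ := GRing.ComUnitRing_isIntegral.Build Zp padic_idomain.

End PadicIntRing.

Notation padic p_pr := {fraction padic_int p_pr}.

Section PadicFields.
Variables (p : nat) (p_pr : prime p).

Definition ring_of_integers (F : fieldExtType (padic p_pr)) : set F :=
  [set x | integralOver (fun z : padic_int p_pr => (tofrac z)%:A : F) x].

(* For a subring O of a field F, with 0^-1 = 0 whence the second condition. *)
Definition unit_of (F : fieldType) (O : set F) (u : F) : Prop :=
  [/\ O u, u != 0 & O u^-1].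

(* The non-units of O are exactly the multiples of w, i.e. w generates the
   maximal ideal of the local ring O. *)
Definition uniformiser (F : fieldType) (O : set F) (w : F) : Prop :=
  O w /\ forall x, O x -> (~ unit_of O x <-> exists2 y, O y & x = w * y).

Variables (K : fieldExtType (padic p_pr)) (L : splittingFieldType K).

(* baseFieldType L is L seen as an extension of Q_p. *)
Definition OK : set K := @ring_of_integers K.
Definition OL : set L := @ring_of_integers (baseFieldType L).
Definition abs_degree : nat := \dim {: baseFieldType L}.

Definition GalLK : {group gal_of {:L}} := 'Gal({:L} / 1)%G.

(* e(L/K) = e, as the equality of ideals (w_K) = (w_L)^e in OL. *)
Definition has_ramification_index (e : nat) : Prop :=
  exists wK wL, [/\ uniformiser OK wK, uniformiser OL wL &
    unit_of OL (wK%:A / wL ^+ e)].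

Definition ramified : Prop :=
  exists2 e, (1 < e)%N & has_ramification_index e.

(* G_i with respect to a uniformiser w of L. *)
Definition lower_ramification_group (w : L) (i : int) : set (gal_of {:L}) :=
  [set g | g \in GalLK /\
    forall x, OL x -> exists2 y, OL y & g x - x = w ^ (i + 1) * y].

Definition ramification_jump (w : L) (t : int) : Prop :=
  -1 <= t /\
  lower_ramification_group w t <> lower_ramification_group w (t + 1).

(* OK[G] a, with G the Galois group *)
Definition galois_orbit_module (a : L) : set L :=
  [set x | exists2 c : gal_of {:L} -> K, (forall g, OK (c g)) &
    x = \sum_(g in GalLK) c g *: g a].

(* [A : B], the number of cosets of B in A, possibly +oo. *)
Definition add_index (R : realType) (V : zmodType) (A B : set V) : \bar R :=
  counting [set [set x + b | b in B] | x in A].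

(* An infimum of elements of N u {+oo}, hence a minimum. *)
Definition minimal_index (R : realType) : \bar R :=
  ereal_inf [set add_index R OL (galois_orbit_module a) | a in OL].

End PadicFields.

Arguments OK {p p_pr} K.
Arguments OL {p p_pr K} L.
Arguments abs_degree {p p_pr K} L.
Arguments ramified {p p_pr K} L.
Arguments ramification_jump {p p_pr K L} w t.
Arguments galois_orbit_module {p p_pr K L} a.
Arguments minimal_index {p p_pr K} L R.

(* Main.v *)
(* L/K is totally ramified, so for a uniformiser w of L the powers 1, ..., w^(p-1)
   have distinct valuations modulo p = v(w_K): they form an O_K-basis of O_L in
   which valuations can be read off.

   Take g in G_t but not in G_(t+1) and put d = g - 1.  Then v(d x) >= v(x) + t,
   with equality if p does not divide v(x), and as p divides t, no nonzero element
   of the image of d has a valuation divisible by p.  Since g^p = 1, the operator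
   sum_k C(p, k+1) d^k kills this image; its two extreme terms must balance, so
   v(p) = (p-1) t, and their leading coefficients give a simple root modulo w_K of
   a polynomial which Hensel's lemma lifts to a primitive p-th root of unity z in K.
   An eigenvector of g in the image of d has valuation prime to p, and multiplying
   one of its powers by a power of w_K yields a uniformiser r of L with r^p in K.

   In the basis r^i the orbit module of sum_i c_i r^i is the set of all vectors
   (c_i Q(z^i))_i with Q in O_K[X] of degree < p.  The Newton polynomials
   prod_(i < k) (X - z^i) make it triangular, with diagonal entries
   c_k prod_(i < k) (z^k - z^i), which is c_k (z - 1)^k up to a unit.  As
   (z - 1)^(p-1) is p up to a unit and [O_K : p O_K] = p^[K : Q_p], the index is
   prod_k [O_K : c_k O_K] times p^([L : Q_p] / 2). *)

Require Import Defs.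
From HB Require Import structures.
From mathcomp Require Import all_boot all_order all_fingroup all_algebra all_field.
From mathcomp Require Import all_solvable.
From mathcomp Require Import all_classical all_reals all_analysis.
From mathcomp Require Import finmap ring zify.

Set Implicit Arguments.
Unset Strict Implicit.
Unset Printing Implicit Defensive.

Import Order.TTheory GRing.Theory Num.Theory.
Local Open Scope ring_scope.

(** * Discrete valuation rings *)

Section Valuation.
Variables (F : fieldType) (O : subringClosed F).
Implicit Types (w x y u : F) (m n : int).

(** K and L come as bare field extensions, without topology or valuation. The hypotheses supply
    uniformisers, and from one of them together with integrality over Z_p the discrete valuation is
    derived. Hensel's lemma also needs completeness, which is pulled back from Z_p through a finite
    Z_p-basis of the integers; the same basis gives the index of pO, and so the degree [K : Q_p] in
    the exponent. The condition p | t acts through residue classes: d raises a valuation by t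
    without changing its class modulo p, so it can be applied to w again and again with exact
    control of the valuation. To leading order d is then multiplication by an element of K. The
    equality v(p) = (p-1) t says that t has the largest value possible for a jump in degree p. The
    factor 1/2 comes from the triangular matrix: its diagonal contributes (z-1)^k for k = 0, ...,
    p-1, in total (z-1)^(p(p-1)/2), whereas (z-1)^(p-1) accounts for p. An element with some c_i = 0
    has an orbit module of smaller rank, so its index is infinite and it never competes for the
    minimum. *)

Definition unit_in u := [&& u != 0, u \in O & u^-1 \in O].

(** Stated without a valuation, in terms that can be checked for an integral closure. The last two
    clauses make F the fraction field of O and exclude nonzero elements divisible by all powers of
    w. *)
Definition dvr w : Prop :=
  [/\ w \in O, w != 0, w^-1 \notin O,
      (forall x, x \in O -> x^-1 \in O \/ x / w \in O) &
      (forall x, exists2 b, b \in O /\ b != 0 & x * b \in O) /\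
      (forall x, x \in O -> x != 0 -> exists n : nat, x / w ^+ n \notin O)].

Definition valu w x : int :=
  if pselect (exists n : int, unit_in (x / w ^ n)) is left h
  then projT1 (cid h) else 0.

(* [valu w 0] is the junk value 0; [vge w n x] reads v(x) >= n with v(0) = +oo. *)
Definition vge w n x := (x == 0) || (n <= valu w x).

Lemma unit_in1 : unit_in 1.
Proof. by rewrite /unit_in invr1 oner_eq0 rpred1. Qed.

Lemma unit_inM x y : unit_in x -> unit_in y -> unit_in (x * y).
Proof.
case/and3P=> x0 Ox Ox' /and3P[y0 Oy Oy'].
by rewrite /unit_in mulf_neq0 // invfM !rpredM.
Qed.

Lemma unit_inV x : unit_in x -> unit_in x^-1.
Proof. by case/and3P=> x0 Ox Ox'; rewrite /unit_in invr_eq0 invrK x0 Ox Ox'. Qed.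

Lemma unit_inX x (k : nat) : unit_in x -> unit_in (x ^+ k).
Proof.
move=> xU; elim: k => [|k IHk]; first exact: unit_in1.
by rewrite exprS unit_inM.
Qed.

Lemma unit_inN x : unit_in (- x) = unit_in x.
Proof. by rewrite /unit_in oppr_eq0 invrN !rpredN. Qed.

Section WithUniformiser.
Variable w : F.
Hypothesis dw : dvr w.

Let w0 : w != 0. Proof. by case: dw. Qed.
Let Ow : w \in O. Proof. by case: dw. Qed.
Let wz0 n : w ^ n != 0. Proof. exact: expfz_neq0. Qed.

Lemma unit_in_wz n : unit_in (w ^ n) -> n = 0.
Proof.
have aux (k : nat) : ~ unit_in (w ^+ k.+1).
  case/and3P=> _ _ wk; case: dw => _ _ /negP[].
  suff ->: w^-1 = w ^+ k * (w ^+ k.+1)^-1 by rewrite rpredM ?rpredX.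
  by rewrite exprS invfM mulrCA mulfV ?mulr1 // expf_neq0.
case: n => [[|k]|k] //; first by move/aux.
by rewrite NegzE -exprnN => /unit_inV; rewrite invrK => /aux.
Qed.

Lemma unit_in_dvr x : x \in O -> x / w \notin O -> unit_in x.
Proof.
move=> Ox xw; have x0 : x != 0.
  by apply: contraNneq xw => ->; rewrite mul0r rpred0.
by rewrite /unit_in x0 Ox; case: dw => _ _ _ /(_ x Ox)[-> //|]; rewrite (negPf xw).
Qed.

(** Dividing x in O by w as long as possible leaves an element of O that is no multiple of w, hence
    a unit; a general x is a quotient of two elements of O. *)
Lemma val_ex x : x != 0 -> exists n : int, unit_in (x / w ^ n).
Proof.
have aux y : y \in O -> y != 0 -> exists n : int, unit_in (y / w ^ n).
  move=> Oy y0; case: (dw) => _ _ _ _ [_ /(_ y Oy y0) Pn].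
  case: (ex_minnP Pn) => -[|n] Pn1 nmin; first by rewrite expr0 divr1 Oy in Pn1.
  exists n%:Z; rewrite -exprnP; apply: unit_in_dvr.
    by apply/negPn/negP => /nmin; rewrite ltnn.
  by rewrite -mulrA -invfM -exprSr.
move=> x0; case: (dw) => _ _ _ _ [/(_ x)[b [Ob b0] Oxb] _].
have [m Um] := aux _ Oxb (mulf_neq0 x0 b0); have [n Un] := aux _ Ob b0.
exists (m - n); rewrite expfzDr // -invr_expz.
have -> : x / (w ^ m / w ^ n) = (x * b / w ^ m) / (b / w ^ n).
  by field; rewrite b0 !wz0.
by rewrite unit_inM ?unit_inV.
Qed.

Lemma valP x : x != 0 -> unit_in (x / w ^ valu w x).
Proof.
by move/val_ex=> h; rewrite /valu; case: pselect => // {}h; case: cid.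
Qed.

Lemma val_eq x n : unit_in (x / w ^ n) -> valu w x = n.
Proof.
move=> xn; have x0 : x != 0 by case/and3P: xn; rewrite mulf_eq0 => /norP[].
apply/eqP; rewrite eq_sym -subr_eq0; apply/eqP; apply: unit_in_wz.
suff -> : w ^ (n - valu w x) = (x / w ^ valu w x) / (x / w ^ n).
  by rewrite unit_inM ?unit_inV ?valP.
by rewrite expfzDr // -invr_expz; field; rewrite x0 !wz0.
Qed.

Lemma val_unit u : unit_in u -> valu w u = 0.
Proof. by move=> uU; apply: val_eq; rewrite expr0z divr1. Qed.

Lemma val_unitE u : u != 0 -> valu w u = 0 -> unit_in u.
Proof. by move=> u0 vu; have := valP u0; rewrite vu expr0z divr1. Qed.

Lemma val1 : valu w 1 = 0. Proof. exact: val_unit unit_in1. Qed.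

Lemma valw : valu w w = 1.
Proof. by apply: val_eq; rewrite expr1z divff // unit_in1. Qed.

Lemma valM x y : x != 0 -> y != 0 -> valu w (x * y) = valu w x + valu w y.
Proof.
move=> x0 y0; apply: val_eq; rewrite expfzDr //.
by rewrite invfM mulrACA unit_inM ?valP.
Qed.

Lemma valV x : x != 0 -> valu w x^-1 = - valu w x.
Proof.
move=> x0; apply/eqP; rewrite -addr_eq0 -valM ?invr_eq0 //.
by rewrite mulVf // val1.
Qed.

Lemma valX x (k : nat) : x != 0 -> valu w (x ^+ k) = k%:Z * valu w x.
Proof.
move=> x0; elim: k => [|k IHk]; first by rewrite val1 mul0r.
by rewrite exprS valM ?expf_neq0 // IHk -[k.+1]add1n PoszD mulrDl mul1r.
Qed.

Lemma valXz x n : x != 0 -> valu w (x ^ n) = n * valu w x.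
Proof.
move=> x0; case: n => k; first exact: valX.
by rewrite NegzE -exprnN valV ?expf_neq0 // valX // mulNr.
Qed.

Lemma valN x : valu w (- x) = valu w x.
Proof.
have [->|x0] := eqVneq x 0; first by rewrite oppr0.
by apply: val_eq; rewrite mulNr unit_inN valP.
Qed.

Lemma vge0E x : vge w 0 x = (x \in O).
Proof.
rewrite /vge; have [->|x0] /= := eqVneq x 0; first by rewrite rpred0.
have /and3P[_ Ox Ox'] := valP x0.
have xE : x = x / w ^ valu w x * w ^ valu w x by rewrite divfK.
case: (valu w x) Ox Ox' xE => k Ok Ok' xE.
  by rewrite xE rpredM // -exprnP rpredX.
rewrite (_ : (0 <= Negz k) = false) //; apply/esym/negP => Ox; case: (dw) => _ _ /negP[].
suff -> : w^-1 = w ^+ k * x * (x / w ^ Negz k)^-1.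
  by rewrite !rpredM ?rpredX.
rewrite NegzE -exprnN invrK exprS; field.
by rewrite x0 expf_neq0 // w0.
Qed.

Lemma vge_val x : vge w (valu w x) x. Proof. by rewrite /vge lexx orbT. Qed.

Lemma vge0 n : vge w n 0. Proof. by rewrite /vge eqxx. Qed.

Lemma vge_trans m n x : m <= n -> vge w n x -> vge w m x.
Proof.
by move=> mn /orP[/eqP-> | nx]; rewrite ?vge0 // /vge (le_trans mn nx) orbT.
Qed.

Lemma vgeE n x : vge w n x = (x / w ^ n \in O).
Proof.
rewrite -vge0E /vge; have [->|x0] := eqVneq x 0; first by rewrite mul0r eqxx.
rewrite mulf_eq0 invr_eq0 (negPf x0) (negPf (wz0 _)) /=.
by rewrite valM ?invr_eq0 // valV // valXz // valw mulr1 subr_ge0.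
Qed.

Lemma vge_wP n x : vge w n x -> exists2 y, y \in O & x = w ^ n * y.
Proof. by rewrite vgeE => Oy; exists (x / w ^ n); rewrite // mulrC divfK. Qed.

Lemma vgeD n x y : vge w n x -> vge w n y -> vge w n (x + y).
Proof. by rewrite !vgeE mulrDl; apply: rpredD. Qed.

Lemma vgeN n x : vge w n (- x) = vge w n x.
Proof. by rewrite !vgeE mulNr rpredN. Qed.

Lemma vgeB n x y : vge w n x -> vge w n y -> vge w n (x - y).
Proof. by move=> ? ?; rewrite vgeD ?vgeN. Qed.

Lemma vgeM m n x y : vge w m x -> vge w n y -> vge w (m + n) (x * y).
Proof.
rewrite !vgeE expfzDr // invfM mulrACA; exact: rpredM.
Qed.

Lemma vgeMl n x y : x \in O -> vge w n y -> vge w n (x * y).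
Proof. by rewrite -vge0E => xO yn; rewrite -[n]add0r vgeM. Qed.

Lemma vge_sum n (I : Type) (r : seq I) (P : pred I) (f : I -> F) :
  (forall i, P i -> vge w n (f i)) -> vge w n (\sum_(i <- r | P i) f i).
Proof. by move=> fn; elim/big_ind: _ => //; [exact: vge0 | exact: vgeD]. Qed.

Lemma vge_all0 x : (forall n : nat, vge w n x) -> x = 0.
Proof.
move=> xn; apply/eqP; apply: contraT => x0.
have := xn (`|valu w x|%N.+1); rewrite /vge (negPf x0) /=; lia.
Qed.

Lemma val_add_dominant x y :
  x != 0 -> vge w (valu w x + 1) y -> x + y != 0 /\ valu w (x + y) = valu w x.
Proof.
move=> x0 yx; have n0 : x + y != 0.
  apply: contraTneq yx => /eqP; rewrite addrC addr_eq0 => /eqP->.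
  by rewrite /vge oppr_eq0 (negPf x0) valN /=; lia.
split=> //; apply/eqP; rewrite eq_le; apply/andP; split.
  rewrite leNgt; apply/negP => lt.
  have : vge w (valu w x + 1) x.
    rewrite -[X in vge _ _ X](addrK y) vgeB //.
    by apply: vge_trans (vge_val _); rewrite lezD1.
  by rewrite /vge (negPf x0) /=; lia.
have : vge w (valu w x) (x + y).
  by rewrite vgeD ?vge_val //; apply: vge_trans yx; lia.
by rewrite /vge (negPf n0).
Qed.

(** The unique term of least valuation dominates, so nothing cancels. The last clause lets a bound
    on the sum pass to every term. Zero terms are exempt from distinctness because [valu] gives them
    a default value. *)
Lemma val_sum_distinct (I : finType) (f : I -> F) :
    (forall i j, f i != 0 -> f j != 0 -> valu w (f i) = valu w (f j) -> i = j) ->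
    (exists i, f i != 0) ->
  let s := \sum_i f i in
  exists i0, [/\ f i0 != 0, s != 0, valu w s = valu w (f i0) &
                 forall i, vge w (valu w s) (f i)].
Proof.
move=> finj [i1 fi1] s.
pose P := [pred i | f i != 0].
pose i0 := Order.arg_min i1 P (fun i => valu w (f i)).
have [fi0 i0min] : f i0 != 0 /\ forall j, P j -> valu w (f i0) <= valu w (f j).
  by rewrite /i0; case: Order.TotalTheory.arg_minP.
have rest : vge w (valu w (f i0) + 1) (\sum_(i | i != i0) f i).
  apply: vge_sum => i ii0; rewrite /vge; have [//|fi /=] := eqVneq (f i) 0.
  have := i0min _ fi; rewrite le_eqVlt => /orP[/eqP e|]; last by lia.
  by case/eqP: ii0; apply: finj.
have [s0 vs] := val_add_dominant fi0 rest.
exists i0; rewrite /s (bigD1 i0) //=; split=> // i; rewrite vs /vge.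
by have [//|fi] := eqVneq (f i) 0; rewrite i0min.
Qed.

End WithUniformiser.
End Valuation.

(** * Hensel's lemma by a modified Newton iteration *)

Section Hensel.
Variables (F : fieldType) (O : subringClosed F).

Definition w_complete (w : F) : Prop :=
  forall y : nat -> F, (forall n, y n \in O) ->
    (forall n : nat, vge O w n (y n.+1 - y n)) ->
  exists2 z, z \in O & forall n : nat, vge O w n (z - y n).

(** The remainder is integral because the Hasse derivatives [nderivn] have integral coefficients,
    with no division by factorials. *)
Lemma taylor2 (G : {poly F}) y h : G \is a polyOver O -> y \in O -> h \in O ->
  exists2 z, z \in O & G.[y + h] = G.[y] + h * G^`().[y] + h ^+ 2 * z.
Proof.
move=> GO yO hO; have sG : (size G <= (size G).+2)%N by rewrite !leqW.
rewrite (nderiv_taylor_wide _ sG); last exact: mulrC.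
rewrite 2!big_ord_recl /= nderivn0 expr0 mulr1 nderivn1 expr1.
rewrite addrA (mulrC h).
exists (\sum_(i < size G) G^`N(i.+2).[y] * h ^+ i).
  apply: rpred_sum => i _; rewrite rpredM ?rpredX //.
  by rewrite rpred_horner ?polyOver_nderivn.
by rewrite mulr_sumr; congr (_ + _); apply: eq_bigr => i _; rewrite [RHS]mulrCA -exprD.
Qed.

Variable w : F.
Hypotheses (dw : dvr O w) (cw : w_complete w).

(** Newton's iteration with the slope frozen at y0, so that a single inverse u is needed.
    Convergence is only linear, one power of w per step, which is exactly the rate that [w_complete]
    asks for. *)
Lemma hensel (G : {poly F}) y0 :
    G \is a polyOver O -> y0 \in O -> vge O w 1 G.[y0] ->
    unit_in O G^`().[y0] ->
  exists2 y, y \in O & root G y /\ vge O w 1 (y - y0).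
Proof.
move=> GO y0O Gy0 /and3P[G'0 G'O uO]; set u := (G^`().[y0])^-1 in uO.
pose y := fix loop n := if n is m.+1 then loop m - u * G.[loop m] else y0.
have yS n : y n.+1 = y n - u * G.[y n] by [].
have yP n : [/\ y n \in O, vge O w 1 (y n - y0) & vge O w n.+1 G.[y n]].
  elim: n => [|n [yO yy0 Gy]]; first by split; rewrite // subrr vge0.
  have GyO : G.[y n] \in O by rewrite rpred_horner.
  pose h := - (u * G.[y n]).
  have hO : h \in O by rewrite rpredN rpredM.
  have vh : vge O w n.+1 h by rewrite vgeN // vgeMl.
  have yhO : y n.+1 \in O by rewrite yS rpredB ?rpredM.
  split=> //.
    rewrite yS addrAC; apply: vgeD => //; exact: vge_trans vh.
  have [z zO] := taylor2 GO yO hO.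
  rewrite yS => ->; apply: vgeD => //; last first.
    apply: (@vge_trans _ _ _ _ (n.+1%:Z + n.+1%:Z)).
      by rewrite -PoszD lez_nat addSnnS leq_addl.
    by rewrite expr2 mulrC vgeMl // vgeM.
  have d0O : y n - y0 \in O by rewrite rpredB.
  have [z' z'O G'y] := taylor2 (polyOver_deriv GO) y0O d0O.
  rewrite addrC subrK in G'y.
  have G''O : G^`()^`().[y0] \in O by rewrite rpred_horner ?polyOver_deriv.
  (* The difference 1 - u G'(y n) is a multiple of y n - y0, hence of w, so the linear part gains
     one power of w. *)
  have -> : G.[y n] + h * G^`().[y n] =
      (- u * (G^`()^`().[y0] + (y n - y0) * z')) * ((y n - y0) * G.[y n]).
    by rewrite G'y /h /u; field.
  apply: vgeMl => //; first by rewrite rpredM ?rpredN ?rpredD ?rpredM.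
  by rewrite -[n.+2]add1n PoszD vgeM.
have [||z zO zy] := cw (y := y).
- by move=> n; case: (yP n).
- move=> n; case: (yP n) => yO _ Gy; rewrite yS addrAC subrr add0r vgeN //.
  by apply: vgeMl => //; apply: vge_trans Gy; rewrite lez_nat.
exists z => //; split; last first.
  have [_ y1 _] := yP 1%N; rewrite -(subrK (y 1%N) z) -addrA.
  by apply: vgeD => //; exact: zy.
apply/eqP; apply: (vge_all0 dw) => n; have [yO _ Gy] := yP n.
have hO : z - y n \in O by rewrite rpredB.
have [z' z'O Gz] := taylor2 GO yO hO; rewrite addrC subrK in Gz.
have G'yO : G^`().[y n] \in O by rewrite rpred_horner ?polyOver_deriv.
rewrite Gz -addrA vgeD //; first by apply: vge_trans Gy; rewrite lez_nat.
have -> : (z - y n) * G^`().[y n] + (z - y n) ^+ 2 * z' =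
   (G^`().[y n] + (z - y n) * z') * (z - y n) by ring.
by rewrite vgeMl // rpredD ?rpredM.
Qed.

End Hensel.

(** * The ring Z_p *)

Section PadicIntegers.
Variables (p : nat) (p_pr : prime p).
Local Notation Zp := (padic_int p_pr).
Implicit Types (x y a b : Zp) (m n : nat).

Let p_gt0 : (0 < p)%N. Proof. exact: prime_gt0. Qed.
Let q_gt0 n : (0 < p ^ n)%N. Proof. by rewrite expn_gt0 p_gt0. Qed.

Lemma residueD x y n : (x + y) n = ((x n + y n) %% (p ^ n)%N%:Z)%Z.
Proof. by []. Qed.
Lemma residueM x y n : (x * y) n = ((x n * y n) %% (p ^ n)%N%:Z)%Z.
Proof. by []. Qed.
Lemma residue_of_int (z : int) n : padic_of_int p_pr z n = (z %% (p ^ n)%N%:Z)%Z.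
Proof. by []. Qed.
Lemma residue0n n : (0 : Zp) n = 0.
Proof. by rewrite residue_of_int mod0z. Qed.
Lemma residue_at0 x : x 0%N = 0.
Proof. by rewrite -(residue_mod x 0) expn0 modz1. Qed.

Lemma residueB_eq0 x y n : (x - y) n = 0 <-> x n = y n.
Proof.
split=> [xy|xy]; last by rewrite residueD /= modzDmr xy subrr mod0z.
by rewrite -(subrK y x) addrC residueD xy addr0 residue_mod.
Qed.

Lemma padic_natE m : (m%:R : Zp) = padic_of_int p_pr m.
Proof.
elim: m => [|m IHm]; first by [].
rewrite -addn1 natrD {}IHm; apply: padic_intP => n.
by rewrite residueD !residue_of_int modzDm PoszD.
Qed.

(** The residues of x / p^n are those of x, shifted by n and divided by p^n. *)
Lemma residue_eq0P x n : reflect (exists y, x = p%:R ^+ n * y) (x n == 0).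
Proof.
have natX : (p%:R ^+ n : Zp) = padic_of_int p_pr (p ^ n)%N.
  by rewrite -natrX padic_natE.
apply: (iffP eqP) => [xn0 | [y ->]]; last first.
  by rewrite natX residueM residue_of_int modzz mul0r mod0z.
have dvd k : ((p ^ n)%N%:Z %| x (n + k)%N)%Z.
  by apply/dvdz_mod0P; rewrite addnC residue_modn.
pose f k := (x (n + k)%N %/ (p ^ n)%N%:Z)%Z.
have fE k : x (n + k)%N = f k * (p ^ n)%N%:Z by rewrite divzK.
have fP k : (f k.+1 %% (p ^ k)%N%:Z)%Z = (f k %% (p ^ k)%N%:Z)%Z.
  have pn0 : (p ^ n)%N%:Z != 0 by rewrite eqz_nat -lt0n.
  have := residueP x (n + k)%N; rewrite -addnS !fE addnC expnD PoszM.
  by rewrite -mulz_modl ?ltz_nat // => /(mulIf pn0) <-; rewrite modz_mod.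
exists (padic_of p_pr fP); apply: padic_intP => k.
by rewrite natX residueM residue_of_int /= modzMm mulrC -fE residue_modn.
Qed.

Lemma residue_pM x n : (p%:R * x) n.+1 = 0 <-> x n = 0.
Proof.
split=> [/eqP/residue_eq0P[y] | /eqP/residue_eq0P[y ->]]; last first.
  by apply/eqP/residue_eq0P; exists y; rewrite exprS mulrA.
rewrite exprS -mulrA => e; apply/eqP/residue_eq0P; exists y; apply: mulfI e.
apply/eqP => p0; have : (p%:R : Zp) 2 = 0 by rewrite p0 residue0n.
rewrite padic_natE residue_of_int modz_small; first by case; lia.
by rewrite /= ltz_nat expnS expn1 ltn_Pmull ?prime_gt1.
Qed.

Lemma padic_p_neq0 : (p%:R : Zp) != 0.
Proof.
apply/eqP => p0; have := residue_pM 1 1; rewrite p0 mul0r residue0n.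
case=> /(_ erefl) + _; rewrite residue_of_int expn1 modz_small //.
by rewrite /= ltz_nat prime_gt1.
Qed.

Lemma padic_factor x : x != 0 -> exists m y, y 1%N <> 0 /\ x = p%:R ^+ m * y.
Proof.
move=> x0; have nzP : exists n, x n != 0.
  apply: contrapT => h; case/eqP: x0; apply: padic_intP => n.
  by rewrite residue0n; apply/eqP; apply: contra_notT h => ?; exists n.
case: (ex_minnP nzP) => -[|m] xm mmin; first by rewrite residue_at0 in xm.
have /residue_eq0P[y xE] : x m == 0.
  by apply/negPn/negP => /mmin; rewrite ltnn.
exists m, y; split=> // /eqP/residue_eq0P[z yE].
by case/negP: xm; apply/residue_eq0P; exists z; rewrite xE yE expr1 exprSr mulrA.
Qed.

(** Bezout for the first residue and p. An inverse modulo p is enough later: where p is a multiple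
    of a uniformiser, 1 + p c is a unit. *)
Lemma padic_inv_mod x : x 1%N <> 0 -> exists b c, x * b = 1 + p%:R * c.
Proof.
move=> /eqP x1; have cop : coprimez (x 1%N) p.
  rewrite coprimezE /= coprime_sym prime_coprime //.
  apply: contra x1 => px; rewrite -(residue_mod x 1) expn1.
  by apply/eqP/dvdz_mod0P; rewrite dvdzE.
have [[u v] /= uv] := coprimezP _ _ cop.
exists (padic_of_int p_pr u).
have /residue_eq0P[c cE] : (x * padic_of_int p_pr u - 1) 1%N == 0.
  apply/eqP; rewrite residueD residueM /= !expn1 modzDml modzDmr.
  rewrite -modzDmr modzNm modzDmr -modzDml modzMmr modzDml.
  by apply/dvdz_mod0P/dvdzP; exists (- v); rewrite -uv; ring.
by exists c; rewrite -[p%:R]expr1 -cE addrC subrK.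
Qed.

(** This is the completeness of Z_p: later terms do not affect the n-th residue of the n-th partial
    sum, so these residues are coherent. *)
Lemma padic_series (a : nat -> Zp) :
  exists s, forall n, exists c, s - \sum_(k < n) p%:R ^+ k * a k = p%:R ^+ n * c.
Proof.
pose S n := \sum_(k < n) p%:R ^+ k * a k.
have SP n : (S n.+1 n.+1 %% (p ^ n)%N%:Z)%Z = (S n n %% (p ^ n)%N%:Z)%Z.
  have SS : S n.+1 = S n + p%:R ^+ n * a n by rewrite /S big_ord_recr.
  rewrite residueP SS residueD.
  have /eqP-> : (p%:R ^+ n * a n) n == 0 by apply/residue_eq0P; exists (a n).
  by rewrite addr0.
exists (padic_of p_pr SP) => n; apply/residue_eq0P.
by rewrite residueD /= modzDmr modzDml subrr mod0z.
Qed.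

End PadicIntegers.

(** * Integral closures of Z_p *)

Lemma fraction_den (A : idomainType) (k : {fraction A}) :
  exists2 b : A, b != 0 & exists a, k * tofrac b = tofrac a.
Proof.
elim/quotW: k => r; exists (frac r).2; first exact: denom_ratioP.
exists (frac r).1; rewrite -[_ * _]/(FracField.mul _ _); apply/eqP.
rewrite piE /FracField.equivf /FracField.mulf.
rewrite !numden_Ratio ?(oner_eq0, mulf_neq0, denom_ratioP) //.
by rewrite !mulr1 mulrC.
Qed.

#[local] Arguments residue : simpl never.

Section IntegralElements.
Variables (p : nat) (p_pr : prime p) (F : fieldExtType (padic p_pr)).
Local Notation Zp := (padic_int p_pr).

Definition zp_in : Zp -> F := in_alg F \o @tofrac Zp.
HB.instance Definition _ := GRing.RMorphism.copy zp_in (in_alg F \o @tofrac Zp).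
Local Notation iota := zp_in.

(** A predicate version of [ring_of_integers], which can carry a subring structure. *)
Definition zint : {pred F} := fun x => `[< ring_of_integers x >].

Lemma zintP x : reflect (integralOver iota x) (x \in zint).
Proof. exact: asboolP. Qed.

Fact zint_subring : subring_closed zint.
Proof.
split=> [|x y|x y]; first by apply/zintP; apply: integral1.
  by move=> /zintP xO /zintP yO; apply/zintP; apply: integral_sub.
by move=> /zintP xO /zintP yO; apply/zintP; apply: integral_mul.
Qed.
HB.instance Definition _ := GRing.isSubringClosed.Build F zint zint_subring.

Lemma iota_inj : injective iota.
Proof.
by move=> x y /(fmorph_inj (in_alg F)) /eqP; rewrite tofrac_eq => /eqP.
Qed.

Lemma zint_iota z : iota z \in zint.
Proof. by apply/zintP; apply: integral_id. Qed.

Lemma zint_p : p%:R \in zint. Proof. exact: rpred_nat. Qed.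

Lemma iota_eq0 z : (iota z == 0) = (z == 0).
Proof. by rewrite -(inj_eq iota_inj) rmorph0. Qed.

Lemma p_neq0 : p%:R != 0 :> F.
Proof. by rewrite -(rmorph_nat iota) iota_eq0 padic_p_neq0. Qed.

Lemma horner_zint (f : {poly Zp}) x : x \in zint -> (map_poly iota f).[x] \in zint.
Proof.
by move=> xO; apply: rpred_horner => //; apply/polyOverP => i;
   rewrite coef_map zint_iota.
Qed.

(** Clearing denominators in a monic equation of 1/p gives 1 + p z = 0 in Z_p, although the first
    residue of the left side is 1. *)
Lemma zint_pV : p%:R^-1 \notin zint.
Proof.
apply/negP => /zintP[f f_mon /eqP fp].
suff [z] : exists z, iota (1 + p%:R * z) = 0.
  move/eqP; rewrite iota_eq0 => /eqP/(congr1 (fun x : Zp => x 1%N)).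
  have /eqP p1 : (p%:R * z) 1%N == 0.
    by apply/residue_eq0P; exists z; rewrite expr1.
  rewrite residueD p1 addr0 residue0n residue_mod residue_of_int expn1.
  by rewrite modz_small //= ltz_nat prime_gt1.
have [n sf] : exists n, size f = n.+1.
  by exists (size f).-1; rewrite prednK // size_poly_gt0 monic_neq0.
have lf : f`_n = 1 by have /monicP := f_mon; rewrite /lead_coef sf.
exists (\sum_(i < n) f`_i * p%:R ^+ (n - i.+1)).
have {fp} : p%:R ^+ n * (map_poly iota f).[p%:R^-1] = 0 by rewrite fp mulr0.
rewrite (@horner_coef_wide _ n.+1) ?(leq_trans (size_poly _ _)) ?sf // => <-.
rewrite mulr_sumr big_ord_recr /= coef_map /= lf rmorph1 mul1r exprVn mulrDr.
rewrite divff ?expf_neq0 ?p_neq0 // rmorphD rmorph1 [RHS]addrC; congr (_ + _).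
rewrite mulr_sumr rmorph_sum; apply: eq_bigr => i _.
rewrite coef_map /= !rmorphM rmorphXn rmorph_nat exprVn.
have -> : p%:R ^+ n = p%:R * p%:R ^+ (n - i.+1) * p%:R ^+ i :> F.
  by rewrite -exprS -exprD; congr (_ ^+ _); have := ltn_ord i; lia.
by field; rewrite expf_neq0 // p_neq0.
Qed.

(** Let b be a common denominator of the coefficients of the minimal polynomial m, of degree d. Then
    b^d m(X / b) is monic with integral coefficients and vanishes at x b. *)
Lemma zint_frac x : exists2 b : Zp, b != 0 & x * iota b \in zint.
Proof.
have [k kP] : exists k : nat -> padic p_pr, forall i, (minPoly 1 x)`_i = (k i)%:A.
  have /polyOverP mO := minPolyOver 1 x.
  suff /choice[k kP] : forall i, exists k, (minPoly 1 x)`_i = k%:A by exists k.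
  by move=> i; have /vlineP[k ->] := mO i; exists k.
set m := minPoly 1 x in kP *; pose d := (size m).-1.
have [b b0 bP] : exists2 b : Zp, b != 0 & forall i, (i < d)%N ->
    exists a, m`_i * iota b = iota a.
  elim: d => [|n [b b0 bP]]; first by exists 1; rewrite ?oner_eq0.
  have [b' b'0 [a' a'E]] := fraction_den (k n).
  exists (b * b') => [|i]; first by rewrite mulf_neq0.
  rewrite ltnS leq_eqVlt => /orP[/eqP-> | /bP[a aE]].
    have {}a'E : (k n)%:A * iota b' = iota a'.
      by rewrite /zp_in /= -a'E -!in_algE rmorphM.
    by exists (a' * b); rewrite kP !rmorphM /= -a'E; ring.
  by exists (a * b'); rewrite !rmorphM /= -aE; ring.
exists b => //; apply/zintP.
pose f := \poly_(i < d.+1) (m`_i * iota b ^+ (d - i)).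
have sm : size m = d.+1 by rewrite /d prednK // size_poly_gt0 monic_neq0 ?monic_minPoly.
have md : m`_d = 1.
  by have /monicP := monic_minPoly 1 x; rewrite /lead_coef -/m sm.
have f_mon : f \is monic.
  by rewrite monicE lead_coef_poly //= subnn expr0 mulr1 md ?oner_eq0.
have f_root : root f (x * iota b).
  rewrite rootE horner_poly.
  have -> : \sum_(i < d.+1) m`_i * iota b ^+ (d - i) * (x * iota b) ^+ i =
     iota b ^+ d * m.[x].
    rewrite (@horner_coef_wide _ d.+1) ?sm // mulr_sumr; apply: eq_bigr => i _.
    have -> : iota b ^+ d = iota b ^+ (d - i) * iota b ^+ i.
      by rewrite -exprD subnK // -ltnS.
    rewrite exprMn [x ^+ i * _]mulrC !mulrA; congr (_ * _).
    by rewrite -[LHS]mulrA mulrC.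
  by rewrite /m minPolyxx mulr0.
apply: integral_root_monic f_mon f_root _; apply/integral_poly => i.
apply/zintP; rewrite coef_poly; case: ltnP => // id; last exact: rpred0.
have [->|id'] := eqVneq i d; first by rewrite subnn mulr1 md rpred1.
have {}id : (i < d)%N by rewrite ltn_neqAle id' -ltnS.
have [a aE] := bP i id; rewrite -(subnSK id) exprS mulrA aE.
by rewrite rpredM ?rpredX ?zint_iota.
Qed.

(** The constant coefficient of a polynomial over Z_p that vanishes at x is a multiple of x; if it
    is zero, a factor X can be cancelled. The induction therefore runs over nonzero rather than
    monic polynomials. *)
Lemma zint_dvd x : x \in zint -> x != 0 ->
  exists2 a : Zp, a != 0 & iota a / x \in zint.
Proof.
move=> xO x0; have /zintP[f f_mon] := xO.
have := monic_neq0 f_mon; elim/poly_ind: f {f_mon} => [|f c IHf]; rewrite ?eqxx //.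
rewrite rootE rmorphD rmorphM /= map_polyX map_polyC !hornerE /= => fc0 fcx.
have [c0|c0] := eqVneq c 0.
  move: fcx; rewrite c0 rmorph0 addr0 mulf_eq0 (negPf x0) orbF.
  move: fc0; rewrite c0 addr0 => fX0.
  by apply: IHf; apply: contraNneq fX0 => ->; rewrite mul0r.
exists c => //; move: fcx; rewrite addrC addr_eq0 => /eqP->.
by rewrite mulNr mulfK // rpredN horner_zint.
Qed.

Lemma ring_of_integersE x : ring_of_integers x = (x \in zint) :> Prop.
Proof. by rewrite /zint /in_mem /= asboolE. Qed.

Lemma unit_ofE x : unit_of (@ring_of_integers _ p_pr F) x <-> unit_in zint x.
Proof.
rewrite /unit_of !ring_of_integersE; split; first by case=> *; exact/and3P.
by case/and3P.
Qed.

Section Uniformiser.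
Variable w : F.
Hypothesis w_unif : uniformiser (@ring_of_integers _ p_pr F) w.

Let wO : w \in zint. Proof. by rewrite -ring_of_integersE; case: w_unif. Qed.

Let nonunitP x : x \in zint -> ~ unit_in zint x <-> exists2 y, y \in zint & x = w * y.
Proof.
move=> xO; have [_ /(_ x)] := w_unif; rewrite ring_of_integersE => /(_ xO) h.
have uE := unit_ofE x; split=> [xU | [y yO xy]].
  have /h[y] : ~ unit_of (@ring_of_integers _ p_pr F) x by move/uE.
  by rewrite ring_of_integersE; exists y.
by move/uE; apply/h; exists y; rewrite ?ring_of_integersE.
Qed.

Lemma p_multiple : exists2 y, y \in zint & p%:R = w * y.
Proof.
apply/nonunitP; first exact: zint_p.
by case/and3P=> _ _; apply/negP/zint_pV.
Qed.

Let w0 : w != 0.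
Proof.
have [y _] := p_multiple; apply: contra_eq_neq => ->.
by rewrite mul0r p_neq0.
Qed.

Let wV : w^-1 \notin zint.
Proof.
apply/negP => wV; have [_ /(_ (ex_intro2 _ _ 1 (rpred1 zint) _))] := nonunitP wO.
by rewrite mulr1 => /(_ erefl)[]; apply/and3P.
Qed.

Let unit_1Dw y : y \in zint -> unit_in zint (1 + w * y).
Proof.
move=> yO; apply/negPn/negP => /negP/nonunitP[|z zO e].
  by rewrite rpredD ?rpredM ?rpred1.
case/negP: wV; suff -> : w^-1 = z - y by rewrite rpredB.
by apply: (mulfI w0); rewrite mulfV // mulrBr -e addrK.
Qed.

Lemma zint_residue_unit (a : Zp) : a 1%N <> 0 -> unit_in zint (iota a).
Proof.
move=> /padic_inv_mod[b [c abc]]; have [y yO py] := p_multiple.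
have := unit_1Dw (rpredM yO (zint_iota c)); rewrite mulrA -py => U.
have {U} : unit_in zint (iota a * iota b).
  by rewrite -rmorphM abc rmorphD rmorph1 rmorphM rmorph_nat.
case/and3P=> + _ abV; rewrite mulf_eq0 => /norP[a0 b0].
rewrite /unit_in a0 zint_iota.
have -> : (iota a)^-1 = iota b * (iota a * iota b)^-1 by field; rewrite a0 b0.
by rewrite rpredM ?zint_iota.
Qed.

(* In a monic equation of w over Z_p, reduce to the first coefficient prime to p:
   it is a unit of O, and so is its sum with any multiple of w. *)
Lemma uniformiser_pow_p : exists k, w ^+ k / p%:R \in zint.
Proof.
have [f f_mon fw] : integralOver iota w by exact/zintP.
suff H : forall j, (exists i, f`_i 1%N <> 0) ->
    w ^+ j * (map_poly iota f).[w] / p%:R \in zint ->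
    exists k, w ^+ k / p%:R \in zint.
  apply: (H 0%N); last by rewrite (eqP fw) mulr0 mul0r rpred0.
  exists (size f).-1; have /monicP := f_mon; rewrite /lead_coef => ->.
  by rewrite residue_of_int expn1 modz_small //= ltz_nat prime_gt1.
elim/poly_ind: f {f_mon fw} => [|f c IHf] j.
  by case=> i; rewrite coef0 residue0n.
case=> i; rewrite coefD coefMX coefC.
rewrite rmorphD rmorphM /= map_polyX map_polyC !hornerE /= => fi.
have [c1|/eqP c1] := eqVneq (c 1%N) 0; last first.
  move=> H; exists j; have : unit_in zint ((map_poly iota f).[w] * w + iota c).
    have cU := zint_residue_unit c1.
    have -> : (map_poly iota f).[w] * w + iota c =
      (1 + w * ((map_poly iota f).[w] / iota c)) * iota c.
      by case/and3P: cU => c0 _ _; field.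
    apply: unit_inM => //; apply: unit_1Dw.
    by case/and3P: cU => _ _ cV; rewrite rpredM // horner_zint.
  case/and3P=> u0 _ uV; rewrite -(mulfK u0 (w ^+ j / p%:R)).
  by rewrite rpredM // mulrAC.
have /residue_eq0P[d cE] : c 1%N == 0 by exact/eqP.
move=> H; apply: (IHf j.+1).
  case: i fi => [|i]; rewrite /= ?add0r //.
  by rewrite addr0 => fi; exists i.
suff -> : w ^+ j.+1 * (map_poly iota f).[w] / p%:R =
   w ^+ j * ((map_poly iota f).[w] * w + iota c) / p%:R - w ^+ j * iota d.
  by apply: rpredB => //; rewrite rpredM ?rpredX ?zint_iota.
rewrite cE expr1 rmorphM rmorph_nat exprSr; field; exact: p_neq0.
Qed.

(** For separatedness: x divides some p^m a' with a' a unit, and p divides some w^k. If w^(k (m+1))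
    divided x, then p^(m+1) would divide p^m a', and 1/p would be integral. *)
Lemma zint_dvr : dvr zint w.
Proof.
split=> // [x xO|]; last split.
- have [/and3P[]|/negP/(nonunitP xO)[y yO ->]] := boolP (unit_in zint x).
    by left.
  by right; rewrite mulrC mulKf.
- move=> x; have [b b0 xb] := zint_frac x.
  by exists (iota b); rewrite ?zint_iota ?iota_eq0.
move=> x xO x0; have [a a0 ax] := zint_dvd xO x0.
have [m [a' [/zint_residue_unit/and3P[a'0 _ a'V] aE]]] := padic_factor a0.
have [k wk] := uniformiser_pow_p.
exists (k * m.+1)%N; apply/negP => xw; case/negP: zint_pV.
have -> : p%:R^-1 = (iota a / x) * (x / w ^+ (k * m.+1)) *
    (w ^+ k / p%:R) ^+ m.+1 * (iota a')^-1.
  rewrite aE rmorphM rmorphXn rmorph_nat exprMn -exprM exprVn exprS.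
  by field; rewrite a'0 x0 p_neq0 !expf_neq0 ?p_neq0.
apply: rpredM a'V; apply: rpredM; [exact: rpredM | exact: rpredX].
Qed.

End Uniformiser.

Lemma dvr_uniformiser w : dvr zint w -> uniformiser (@ring_of_integers _ p_pr F) w.
Proof.
move=> dw; have [wO w0 wV _ _] := dw.
split=> [|x]; rewrite ring_of_integersE // => xO; rewrite unit_ofE; split.
  move/negP=> xU; exists (x / w); last by rewrite mulrC divfK.
  rewrite ring_of_integersE; apply: contraT => /(unit_in_dvr dw xO).
  by rewrite (negPf xU).
case=> y; rewrite ring_of_integersE => yO ->.
case/and3P=> wy0 _ wyV; case/negP: wV.
have y0 : y != 0 by apply: contraNneq wy0 => ->; rewrite mulr0.
have -> : w^-1 = y * (w * y)^-1 by field; rewrite y0 w0.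
exact: rpredM.
Qed.

End IntegralElements.

Arguments zint {p p_pr} F.
Arguments zp_in {p p_pr} F.

(* [A : B] = N, witnessed by a transversal of the cosets. *)
Definition has_index (V : zmodType) (A B : V -> Prop) (N : nat) : Prop :=
  exists (T : finType) (rep : T -> V),
    [/\ #|T| = N, forall t, A (rep t),
        forall s t, B (rep s - rep t) -> s = t &
        forall x, A x -> exists t, B (x - rep t)].

(** * Z_p-bases of the integers, the index of p, and completeness *)

Section IntegralBasis.
Variables (p : nat) (p_pr : prime p) (F : fieldExtType (padic p_pr)) (w : F).
Hypothesis w_unif : uniformiser (@ring_of_integers _ p_pr F) w.
Local Notation Zp := (padic_int p_pr).
Local Notation iota := (zp_in F).
Local Notation O := (zint F).

Let dw : dvr O w. Proof. exact: zint_dvr. Qed.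

(* Linear independence of the classes in O/pO over Z/p. *)
Definition p_indep m (x : 'I_m -> F) : Prop :=
  forall a : 'I_m -> Zp, (\sum_i iota (a i) * x i) / p%:R \in O ->
    forall i, a i 1%N = 0.

Lemma p_separated x : (forall n, x / p%:R ^+ n \in O) -> x = 0.
Proof.
move=> xn; apply: (vge_all0 dw) => n; rewrite vgeE //.
have [y yO py] := p_multiple w_unif; have [_ w0 _ _ _] := dw.
have y0 : y != 0 by have := p_neq0 F; rewrite py mulf_eq0 => /norP[].
have -> : x / w ^ n = x / p%:R ^+ n * y ^+ n.
  by rewrite py exprMn invfM mulrA mulfVK // expf_neq0.
by rewrite rpredM ?rpredX.
Qed.

(** Descent: independence modulo p makes all coefficients of a relation divisible by p, and dividing
    by p gives another relation. *)
Lemma p_indep_free m (x : 'I_m -> F) (a : 'I_m -> Zp) :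
  p_indep x -> \sum_i iota (a i) * x i = 0 -> forall i, a i = 0.
Proof.
move=> xP a0 i; apply: padic_intP => n; rewrite residue0n.
elim: n a a0 i => [|n IHn] a a0 i; first exact: residue_at0.
have a1 j : exists b, a j = p%:R * b.
  suff /eqP/residue_eq0P[b ->] : a j 1%N = 0 by exists b; rewrite expr1.
  by apply: xP; rewrite a0 mul0r rpred0.
have /choice[b bE] := a1; rewrite bE; apply/residue_pM; apply: IHn.
apply: (mulfI (p_neq0 F)); rewrite mulr0 -[RHS]a0 mulr_sumr.
by apply: eq_bigr => j _; rewrite bE rmorphM rmorph_nat mulrA.
Qed.

Lemma common_den m (k : 'I_m -> padic p_pr) :
  exists2 b : Zp, b != 0 & forall i, exists a, k i * tofrac b = tofrac a.
Proof.
have /choice[d dP] : forall i, exists d : Zp, d != 0 /\ exists a, k i * tofrac d = tofrac a.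
  by move=> i; have [d d0 dP] := fraction_den (k i); exists d.
exists (\prod_i d i) => [|i]; first by apply/prodf_neq0 => i _; case: (dP i).
have [_ [a aE]] := dP i; exists (a * \prod_(j | j != i) d j).
by rewrite (bigD1 i) //= !rmorphM /= mulrA aE.
Qed.

Lemma p_indep_lindep m (x : 'I_m -> F) :
  p_indep x -> free [tuple x i | i < m].
Proof.
move=> xP; apply/freeP => k k0 i.
have [b b0 /choice[a aE]] := common_den k.
have a0 : \sum_i iota (a i) * x i = 0.
  transitivity (iota b * \sum_(i < m) k i *: [tuple x i | i < m]`_i); last first.
    by rewrite k0 mulr0.
  rewrite mulr_sumr; apply: eq_bigr => j _.
  rewrite -tnth_nth tnth_mktuple /zp_in /= -aE.
  by rewrite -!scalerAl mul1r -scalerAr mul1r scalerA mulrC.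
have /(congr1 (@tofrac _)) := p_indep_free xP a0 i.
rewrite -aE rmorph0 => /eqP; rewrite mulf_eq0 tofrac_eq0 (negPf b0) orbF.
by move/eqP.
Qed.

Lemma p_indep_leq m (x : 'I_m -> F) : p_indep x -> (m <= \dim {:F})%N.
Proof.
move/p_indep_lindep => xf; have /eqP := xf; rewrite size_tuple => <-.
exact/dimvS/subvf.
Qed.

Lemma ex_max_p_indep : exists m (x : 'I_m -> F),
  [/\ p_indep x, forall i, x i \in O &
      forall (x' : 'I_m.+1 -> F), p_indep x' -> (forall i, x' i \in O) -> False].
Proof.
pose P m := `[< exists x : 'I_m -> F, p_indep x /\ forall i, x i \in O >].
have exP : exists m, P m.
  by exists 0%N; apply/asboolP; exists (fun=> 0); split=> [a _|] [].
have [|m /asboolP[x [xP xO]] mmax] := @ex_maxnP P (\dim {:F}) exP.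
  by move=> m /asboolP[x [/p_indep_leq]].
exists m, x; split=> // x' x'P x'O.
suff /mmax : P m.+1 by rewrite ltnn.
by apply/asboolP; exists x'.
Qed.

(** By maximality, adjoining y creates a relation modulo p. The coefficient of y in it is invertible
    modulo p, since otherwise it would be a relation among the x i alone. *)
Lemma p_spanning m (x : 'I_m -> F) : p_indep x -> (forall i, x i \in O) ->
    (forall x' : 'I_m.+1 -> F, p_indep x' -> (forall i, x' i \in O) -> False) ->
  forall y, y \in O ->
    exists a : 'I_m -> Zp, (y - \sum_i iota (a i) * x i) / p%:R \in O.
Proof.
move=> xP xO xmax y yO; apply: contrapT => ny.
pose x' i := oapp x y (unlift ord0 i).
have x'S (i : 'I_m) : x' (lift ord0 i) = x i by rewrite /x' liftK.
have x'0 : x' ord0 = y by rewrite /x' unlift_none.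
have x'O i : x' i \in O by rewrite /x'; case: (unlift _ _) => [j|] /=.
apply: (xmax x' _ x'O) => a.
rewrite big_ord_recl x'0 => aO.
have [a01|/eqP a01] := eqVneq (a ord0 1%N) 0; last first.
  case: ny; have [b [c abc]] := padic_inv_mod a01.
  exists (fun i => - (b * a (lift ord0 i))).
  set s := \sum_(i < m) _ in aO.
  have -> : \sum_i iota (- (b * a (lift ord0 i))) * x i = - (iota b * s).
    rewrite mulr_sumr -sumrN; apply: eq_bigr => i _.
    by rewrite x'S rmorphN rmorphM /= mulNr mulrA.
  have -> : (y - - (iota b * s)) / p%:R =
      iota b * ((iota (a ord0) * y + s) / p%:R) - iota c * y.
    have : iota (a ord0) * iota b = 1 + p%:R * iota c.
      by rewrite -rmorphM abc rmorphD rmorph1 rmorphM rmorph_nat.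
    move=> e; have -> : iota b * ((iota (a ord0) * y + s) / p%:R) =
       (iota (a ord0) * iota b * y + iota b * s) / p%:R by ring.
    by rewrite e; field; rewrite p_neq0.
  by apply: rpredB; apply: rpredM => //; exact: zint_iota.
have /eqP/residue_eq0P[b bE] := a01.
have as0 : forall i, a (lift ord0 i) 1%N = 0.
  apply: xP; set s := \sum_i _.
  have sE : \sum_(i < m) iota (a (lift ord0 i)) * x' (lift ord0 i) = s.
    by apply: eq_bigr => i _; rewrite x'S.
  rewrite sE bE expr1 rmorphM rmorph_nat in aO.
  have -> : s / p%:R = (p%:R * iota b * y + s) / p%:R - iota b * y.
    by field; rewrite p_neq0.
  by rewrite rpredB // rpredM // zint_iota.
by move=> i; case: (unliftP ord0 i) => [j|] ->.
Qed.

Lemma p_adic_series m (x : 'I_m -> F) (a : nat -> 'I_m -> Zp) :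
    (forall i, x i \in O) ->
  exists s : 'I_m -> Zp, forall n,
    (\sum_i iota (s i) * x i
      - \sum_(k < n) p%:R ^+ k * \sum_i iota (a k i) * x i) / p%:R ^+ n \in O.
Proof.
move=> xO; have /choice[s sP] := fun i => padic_series (fun n => a n i).
exists s => n; have /choice[c cE] := fun i => sP i n.
have -> : \sum_(k < n) p%:R ^+ k * (\sum_i iota (a k i) * x i) =
    \sum_i iota (\sum_(k < n) p%:R ^+ k * a k i) * x i.
  under eq_bigr do rewrite mulr_sumr.
  rewrite exchange_big; apply: eq_bigr => i _ /=.
  rewrite rmorph_sum mulr_suml; apply: eq_bigr => k _.
  by rewrite rmorphM rmorphXn rmorph_nat mulrA.
rewrite -sumrB mulr_suml; apply: rpred_sum => i _.
rewrite -mulrBl -rmorphB cE rmorphM rmorphXn rmorph_nat.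
rewrite -[X in X / _]mulrA [X in X / _]mulrC mulfK ?expf_neq0 ?p_neq0 //.
by apply: rpredM; [exact: zint_iota | exact: xO].
Qed.

(* Successive approximation: a maximal p-independent family spans O modulo p,
   hence over Z_p because Z_p is complete and O is p-adically separated. *)
Lemma integral_basis : exists m (x : 'I_m -> F),
  [/\ m = \dim {:F}, forall i, x i \in O, p_indep x &
      forall y, y \in O -> exists a : 'I_m -> Zp, y = \sum_i iota (a i) * x i].
Proof.
have [m [x [xP xO xmax]]] := ex_max_p_indep.
have span y : y \in O -> exists a : 'I_m -> Zp, y = \sum_i iota (a i) * x i.
  move=> yO.
  have step z : exists az : ('I_m -> Zp) * F, z \in O ->
      az.2 \in O /\ z = \sum_i iota (az.1 i) * x i + p%:R * az.2.
    have [zO|zO] := boolP (z \in O); last by exists (fun=> 0, 0).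
    have [a aO] := p_spanning xP xO xmax zO.
    exists (a, (z - \sum_i iota (a i) * x i) / p%:R) => _; split=> //=.
    by rewrite mulrC divfK ?p_neq0 // addrC subrK.
  have /choice[f fP] := step.
  pose z n := iter n (fun z => (f z).2) y.
  have zO n : z n \in O by elim: n => // n IHn; case: (fP _ IHn).
  have yz n : y = \sum_(k < n) p%:R ^+ k * (\sum_i iota ((f (z k)).1 i) * x i)
                   + p%:R ^+ n * z n.
    elim: n => [|n IHn]; first by rewrite big_ord0 add0r mul1r.
    rewrite big_ord_recr /= {1}IHn -addrA; congr (_ + _).
    rewrite exprSr -mulrA -mulrDr; congr (_ * _).
    by have [_] := fP _ (zO n).
  have [s sP] := p_adic_series (fun k => (f (z k)).1) xO.
  exists s; apply/eqP; rewrite -subr_eq0; apply/eqP; apply: p_separated => n.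
  have := sP n; set S := \sum_(k < n) _ => SO.
  have -> : (y - \sum_i iota (s i) * x i) / p%:R ^+ n =
     z n - (\sum_i iota (s i) * x i - S) / p%:R ^+ n.
    by rewrite {1}(yz n) -/S; field; rewrite expf_neq0 // p_neq0.
  by rewrite rpredB.
exists m, x; split=> //; apply/eqP; rewrite eqn_leq (p_indep_leq xP) /=.
have -> : {:F}%VS = <<[tuple x i | i < m]>>%VS.
  apply/vspaceP => v; rewrite memvf; symmetry.
  have [b b0 /span[a vb]] := zint_frac v.
  have : v * iota b \in <<[tuple x i | i < m]>>%VS.
    rewrite vb; apply: rpred_sum => i _.
    rewrite /zp_in /= -scalerAl mul1r; apply/memvZ/memv_span.
    by apply: map_f; rewrite mem_enum.
  rewrite /zp_in /= -scalerAr mulr1 => /(memvZ (tofrac b)^-1).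
  by rewrite scalerA mulVf ?scale1r // tofrac_eq0.
by rewrite (leq_trans (dim_span _)) // size_tuple.
Qed.

(** The transversal consists of the combinations of an integral basis with digits 0, ..., p - 1. *)
Lemma index_p : has_index (fun x => x \in O) (fun x => x / p%:R \in O) (p ^ \dim {:F})%N.
Proof.
have [m [x [<- xO xP xspan]]] := integral_basis.
exists {ffun 'I_m -> 'I_p}, (fun f : {ffun 'I_m -> 'I_p} => \sum_i (f i)%:R * x i).
have p_gt1 := prime_gt1 p_pr.
split=> [|f|f g|y yO].
- by rewrite card_ffun !card_ord.
- by apply: rpred_sum => i _; apply: rpredM; [exact: rpred_nat | exact: xO].
- rewrite -sumrB => fgO; apply/ffunP => i; apply/val_inj.
  pose a (i : 'I_m) : Zp := (f i)%:R - (g i)%:R.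
  have ai : a i 1%N = 0.
    apply: xP; under eq_bigr do rewrite rmorphB !rmorph_nat mulrBl.
    exact: fgO.
  have : ((f i)%:R : Zp) 1%N = ((g i)%:R : Zp) 1%N.
    exact/residueB_eq0.
  rewrite !padic_natE !residue_of_int expn1 !modz_small ?ltz_nat ?ltn_ord //.
  by case.
have [a ->] := xspan y yO.
have /choice[f fP] i : exists j : 'I_p, a i 1%N = j.
  have ap : `|a i 1%N|%N = a i 1%N :> int.
    rewrite gez0_abs // -(residue_mod (a i) 1) modz_ge0 //.
    by rewrite eqz_nat expn1 -lt0n prime_gt0.
  have lt : (`|a i 1%N|%N < p)%N.
    rewrite -ltz_nat ap -(residue_mod (a i) 1) expn1.
    by rewrite ltz_pmod // ltz_nat prime_gt0.
  by exists (Ordinal lt).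
exists [ffun i => f i]; rewrite -sumrB mulr_suml; apply: rpred_sum => i _.
rewrite ffunE -mulrBl; have /residue_eq0P[b bE] : (a i - (f i)%:R) 1%N == 0.
  apply/eqP/residueB_eq0; rewrite fP padic_natE residue_of_int expn1.
  by rewrite modz_small // ltz_nat ltn_ord.
have -> : iota (a i) - (f i)%:R = p%:R * iota b.
  by rewrite -(rmorph_nat iota (f i)) -rmorphB bE expr1 rmorphM rmorph_nat.
rewrite -[X in X / _]mulrA [X in X / _]mulrC mulfK ?p_neq0 //.
by apply: rpredM; [exact: zint_iota | exact: xO].
Qed.

(** Since p divides w^e, the differences of y along the multiples of e are divisible by growing
    powers of p; in an integral basis they turn into convergent series over Z_p. *)
Lemma zint_complete : w_complete O w.
Proof.
have [m [x [_ xO _ xspan]]] := integral_basis; move=> y yO yc.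
have [u uO pu] := p_multiple w_unif; have [k wk] := uniformiser_pow_p w_unif.
have [wO w0 _ _ _] := dw; have p0 := p_neq0 F.
have u0 : u != 0 by move: p0; rewrite pu mulf_eq0 => /norP[].
(* The exponent must be positive: then e n >= n, and y (e n) agrees with y n modulo w^n. *)
pose e := k.+1.
have we : w ^+ e / p%:R \in O by rewrite exprS -mulrA rpredM.
have ycl (n j : nat) : vge O w n (y (n + j)%N - y n).
  elim: j => [|j IHj]; first by rewrite addn0 subrr vge0.
  rewrite -(subrK (y (n + j)%N) (y _)) -addrA vgeD // addnS.
  by apply: vge_trans (yc _); rewrite lez_nat leq_addr.
have step n : exists a : 'I_m -> Zp,
    y (e * n.+1)%N - y (e * n)%N = p%:R ^+ n * \sum_i iota (a i) * x i.
  have : (y (e * n.+1)%N - y (e * n)%N) / p%:R ^+ n \in O.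
    have := ycl (e * n)%N e; rewrite -mulnSr vgeE // => dO.
    have -> : (y (e * n.+1)%N - y (e * n)%N) / p%:R ^+ n =
        (y (e * n.+1)%N - y (e * n)%N) / w ^ (e * n)%N * (w ^+ e / p%:R) ^+ n.
      by rewrite exprMn -exprM exprVn mulrA -exprnP divfK ?expf_neq0.
    by rewrite rpredM ?rpredX.
  by move=> /xspan[a aE]; exists a; rewrite -aE mulrC divfK ?expf_neq0.
have /choice[a aE] := step.
have [s sP] := p_adic_series a xO; set S := \sum_i _ in sP.
have SO : S \in O.
  by apply: rpred_sum => i _; apply: rpredM; [exact: zint_iota | exact: xO].
exists (y 0%N + S) => [|n]; first by rewrite rpredD.
have yE j : y (e * j)%N = y 0%N + \sum_(k < j) p%:R ^+ k * \sum_i iota (a k i) * x i.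
  elim: j => [|j IHj]; first by rewrite big_ord0 addr0 muln0.
  by rewrite big_ord_recr /= addrA -IHj -aE addrC subrK.
rewrite -(subrK (y (e * n)%N) (_ + S)) -addrA vgeD //; last first.
  have -> : (e * n = n + (k * n))%N by rewrite mulSn.
  exact: ycl.
rewrite yE opprD addrACA subrr add0r vgeE //.
have := sP n; set D := S - _ => DO.
have -> : D / w ^ n = D / p%:R ^+ n * u ^+ n.
  by rewrite pu exprMn invfM -exprnP; field; rewrite !expf_neq0.
by rewrite rpredM ?rpredX.
Qed.

End IntegralBasis.

(** * Indices of additive subgroups *)

Definition subgroup_of (V : zmodType) (B : V -> Prop) : Prop :=
  B 0 /\ forall x y, B x -> B y -> B (x - y).

Section Index.
Variable V : zmodType.
Implicit Types (A B C : V -> Prop) (N M : nat).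

Lemma subgroupN B x : subgroup_of B -> B x -> B (- x).
Proof. by case=> B0 BB Bx; rewrite -sub0r; apply: BB. Qed.

Lemma subgroupD B x y : subgroup_of B -> B x -> B y -> B (x + y).
Proof.
move=> gB Bx By; rewrite -(opprK y); case: (gB) => _; apply => //.
exact: subgroupN.
Qed.

Lemma subgroupC B x y : subgroup_of B -> B (x - y) -> B (y - x).
Proof. by move=> gB Bx; rewrite -opprB; apply: subgroupN. Qed.

Lemma subgroup_trans B x y z : subgroup_of B -> B (x - y) -> B (y - z) -> B (x - z).
Proof. by move=> gB Bx By; rewrite -(subrK y x) -addrA; apply: subgroupD. Qed.

Lemma eq_index A B B' N : (forall x, A x -> B x <-> B' x) -> subgroup_of A ->
  has_index A B N -> has_index A B' N.
Proof.
move=> BB' gA [T [rep [cT repA repI repC]]]; exists T, rep; split=> // [s t|x Ax].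
  by move/BB' => h; apply/repI/h; case: gA => _; apply.
by have [t] := repC x Ax; exists t; apply/BB' => //; case: gA => _; apply.
Qed.

Lemma index_leq A B N M : subgroup_of B ->
  has_index A B N -> has_index A B M -> (N <= M)%N.
Proof.
move=> gB [T [rep [<- repA repI _]]] [S [rep' [<- _ _ repC]]].
have /choice[f fP] t := repC _ (repA t).
apply: (@leq_card _ _ f) => s t fst; apply: repI.
apply: subgroup_trans (fP s) _ => //; rewrite fst; exact: subgroupC.
Qed.

Lemma index_uniq A B N M : subgroup_of B ->
  has_index A B N -> has_index A B M -> N = M.
Proof.
by move=> gB hN hM; apply/eqP; rewrite eqn_leq !(index_leq gB hN hM, index_leq gB hM hN).
Qed.

Lemma index_gt0 A B N : A 0 -> has_index A B N -> (0 < N)%N.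
Proof. by move=> A0 [T [rep [<- _ _ /(_ 0 A0)[t _]]]]; apply/card_gt0P; exists t. Qed.

Lemma index_tower A B C N M : subgroup_of A -> subgroup_of B ->
    (forall x, B x -> A x) -> (forall x, C x -> B x) ->
  has_index A B N -> has_index B C M -> has_index A C (N * M).
Proof.
move=> gA gB BA CB [T [rep [<- repA repI repC]]] [S [rep' [<- repA' repI' repC']]].
exists (T * S)%type, (fun ts => rep ts.1 + rep' ts.2); split=> [|[t s]|[t s] [t' s']|x Ax] /=.
- by rewrite card_prod.
- by apply: subgroupD => //; apply: BA.
- rewrite opprD addrACA => h.
  have tt' : t = t'.
    apply: repI; rewrite -(addrK (rep' s - rep' s') (rep t - rep t')).
    by case: (gB) => _; apply; [exact: CB | case: gB => _; apply].
  by move: h; rewrite tt' subrr add0r => /repI'->.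
have [t xt] := repC x Ax; have [s ts] := repC' _ xt.
by exists (t, s); rewrite opprD addrA.
Qed.

(** A transversal for the smaller group C meets every coset of B; [r] keeps one representative in
    each of them. *)
Lemma index_finite A B C N : subgroup_of B -> (forall x, C x -> B x) ->
  has_index A C N -> exists M, has_index A B M.
Proof.
move=> gB CB [T [rep [_ repA _ repC]]].
pose r t := odflt t [pick s | `[< B (rep t - rep s) >]].
have rP t : B (rep t - rep (r t)).
  rewrite /r; case: pickP => [s /asboolP//|/(_ t)/asboolP[]].
  by rewrite subrr; case: gB.
have rI s t : B (rep s - rep t) -> r s = r t.
  move=> st; rewrite /r; suff /eq_pick-> : (fun u => `[< B (rep s - rep u) >])
      =1 (fun u => `[< B (rep t - rep u) >]).
    case: pickP => // /(_ t)/asboolP[]; rewrite subrr; by case: gB.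
  move=> u; apply: asbool_equiv_eq; split; apply: subgroup_trans => //.
  exact: subgroupC.
exists #|{: {t : T | r t == t}}|, {t : T | r t == t}, (rep \o val); split=> //.
- by move=> t; apply: repA.
- by move=> [s /= rs] [t /= rt] /rI; rewrite (eqP rs) (eqP rt) => st; apply: val_inj.
move=> x /repC[t xt]; have rr : r (r t) == r t.
  by apply/eqP/rI; apply: (subgroupC gB).
by exists (exist _ (r t) rr); apply: subgroup_trans (rP t) => //; apply: CB.
Qed.

Lemma index1 A B : A 0 -> (forall x, A x -> B x) -> has_index A B 1.
Proof.
move=> A0 AB; exists unit, (fun=> 0); split=> [|//|[] []//|x Ax].
  exact: card_unit.
by exists tt; rewrite subr0; apply: AB.
Qed.

Lemma index1_sub A B : subgroup_of A -> subgroup_of B -> has_index A B 1 ->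
  forall x, A x -> B x.
Proof.
move=> [A0 _] gB [T [rep [cT _ _ repC]]] x Ax.
have [t0 B0] := repC 0 A0; have [t Bt] := repC x Ax.
have tt0 : t = t0.
  have /card_le1_eqP h : (#|T| <= 1)%N by rewrite cT.
  exact: h.
rewrite -[x]subr0; apply: subgroup_trans Bt _ => //; rewrite tt0.
exact: subgroupC.
Qed.

End Index.

Lemma index_scale (F : fieldType) (A B : F -> Prop) c N : c != 0 ->
  has_index A B N -> has_index (fun x => A (x / c)) (fun x => B (x / c)) N.
Proof.
move=> c0 [T [rep [cT repA repI repC]]]; exists T, (fun t => rep t * c).
split=> // [t|s t|x /repC[t]]; first by rewrite mulfK.
  by rewrite -mulrBl mulfK //; apply: repI.
by exists t; rewrite mulrBl mulfK.
Qed.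

Section AddIndex.
Variables (R : realType) (V : zmodType).
Implicit Types A B : set V.

Lemma add_indexE A B N : subgroup_of B -> has_index A B N ->
  add_index R A B = (N%:R)%:E.
Proof.
move=> gB [T [rep [<- repA repI repC]]]; rewrite /add_index.
pose coset x := [set x + b | b in B]%classic.
have cosetE x y : B (x - y) -> coset x = coset y.
  move=> xy; apply/seteqP; split=> z [b Bb <-].
    exists (x - y + b); first exact: subgroupD.
    by rewrite addrA addrCA subrr addr0.
  exists (y - x + b); first by apply: subgroupD => //; apply: subgroupC.
  by rewrite addrA addrCA subrr addr0.
have coset_inj : injective (coset \o rep).
  move=> s t /= st; apply: repI; have : coset (rep s) (rep s).
    by exists 0; rewrite ?addr0; case: gB.
  by rewrite st => -[b Bb <-]; rewrite addrC addKr.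
have -> : [set coset x | x in A]%classic
    = [set` [fset (coset \o rep) t | t in T]%fset]%classic.
  apply/seteqP; split=> [_ [x /repC[t xt] <-]|_ /= /imfsetP[t /= _ ->]].
    by rewrite /= (cosetE _ _ xt); apply/imfsetP; exists t.
  by exists (rep t).
rewrite /counting asboolT; last exact: finite_fset.
by rewrite set_fsetK card_imfset //= -cardE.
Qed.

Lemma add_index_oo A B : subgroup_of B ->
    (exists f : nat -> V, (forall n, A (f n)) /\
       forall m n, B (f m - f n) -> m = n) ->
  add_index R A B = +oo%E.
Proof.
move=> gB [f [fA fI]]; rewrite /add_index /counting asboolF //.
pose g n := [set f n + b | b in B]%classic.
move=> finS; have : finite_set (range g).
  by apply: sub_finite_set finS => _ [n _ <-]; exists (f n).
rewrite (eq_finite_set (inj_card_eq _)) => [|m n _ _ gmn]; first exact: infinite_nat.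
apply: fI; have : g m (f m) by exists 0; rewrite ?addr0; case: gB.
by rewrite gmn => -[b Bb <-]; rewrite addrC addKr.
Qed.

End AddIndex.

(** * Indices of principal ideals and change of uniformiser *)

Section IndexInDvr.
Variables (F : fieldType) (O : subringClosed F) (w : F).
Hypothesis dw : dvr O w.

Lemma subgroup_mulO c : subgroup_of (fun x => x / c \in O).
Proof.
by split=> [|x y xO yO]; rewrite ?mul0r ?rpred0 // mulrBl rpredB.
Qed.

Lemma subgroupO : subgroup_of (fun x => x \in O).
Proof. by split=> [|x y]; [exact: rpred0 | exact: rpredB]. Qed.

Lemma mulO_sub c x : c != 0 -> c \in O -> x / c \in O -> x \in O.
Proof. by move=> c0 cO xO; rewrite -(divfK c0 x) rpredM. Qed.

Lemma index_mulO c d N M : c != 0 -> d != 0 -> c \in O -> d \in O ->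
    has_index (fun x => x \in O) (fun x => x / c \in O) N ->
    has_index (fun x => x \in O) (fun x => x / d \in O) M ->
  has_index (fun x => x \in O) (fun x => x / (c * d) \in O) (N * M).
Proof.
move=> c0 d0 cO dO hc /(index_scale c0) hd.
apply: index_tower hc _; [exact: subgroupO | exact: subgroup_mulO | | |].
- by move=> x; apply: mulO_sub.
- by move=> x; rewrite invfM mulrA; apply: mulO_sub.
- by apply: eq_index hd => [x _|]; [rewrite invfM mulrA | exact: subgroup_mulO].
Qed.

Lemma index_unit u : unit_in O u ->
  has_index (fun x => x \in O) (fun x => x / u \in O) 1.
Proof. by case/and3P=> _ _ uV; apply: index1 => [|x xO]; rewrite ?rpred0 ?rpredM. Qed.

Lemma index1_unit c : c != 0 -> c \in O ->
  has_index (fun x => x \in O) (fun x => x / c \in O) 1 -> unit_in O c.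
Proof.
move=> c0 cO /(index1_sub subgroupO (subgroup_mulO c))/(_ 1 (rpred1 O)).
by rewrite mul1r => cV; apply/and3P.
Qed.

Lemma index_dvr c : (exists N, has_index (fun x => x \in O) (fun x => x / w \in O) N) ->
  c != 0 -> c \in O -> exists N, has_index (fun x => x \in O) (fun x => x / c \in O) N.
Proof.
move=> [N hw] c0 cO; have [wO w0 _ _ _] := dw.
have hwn n : has_index (fun x => x \in O) (fun x => x / w ^+ n \in O) (N ^ n).
  elim: n => [|n IHn]; first by rewrite expr0; apply/index_unit/unit_in1.
  by rewrite exprS expnS; apply: index_mulO; rewrite ?expf_neq0 ?rpredX.
have [n nE] : exists n : nat, valu O w c = n.
  by move: cO; rewrite -(vge0E dw) /vge (negPf c0) /=; case: (valu O w c) => // n; exists n.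
have cU := valP dw c0; rewrite nE -exprnP in cU; exists (N ^ n * 1)%N.
have -> : c = w ^+ n * (c / w ^+ n) by rewrite mulrC divfK ?expf_neq0.
have /and3P[u0 uO _] := cU.
by apply: index_mulO; rewrite ?expf_neq0 ?rpredX //; apply: index_unit.
Qed.

Lemma valu0 w' : valu O w' 0 = 0.
Proof.
have no : ~ exists n : int, unit_in O (0 / w' ^ n).
  by case=> n; rewrite mul0r /unit_in eqxx.
by rewrite /valu; case: pselect.
Qed.

Lemma valu_unif w' : dvr O w' -> valu O w w' = 1.
Proof.
move=> dw'; have [wO w0 wV wu _] := dw; have [w'O w'0 w'V w'u _] := dw'.
apply: (val_eq dw); rewrite expr1z; apply/and3P; split.
- by rewrite mulf_neq0 ?invr_eq0.
- by have [|//] := wu _ w'O; rewrite (negPf w'V).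
- by rewrite invf_div; have [|//] := w'u _ wO; rewrite (negPf wV).
Qed.

Lemma valu_indep w' x : dvr O w' -> valu O w' x = valu O w x.
Proof.
move=> dw'; have [->|x0] := eqVneq x 0.
  by rewrite !valu0.
have [_ w'0 _ _ _] := dw'.
have U := valP dw' x0; set n := valu O w' x in U *; have /and3P[u0 _ _] := U.
have -> : valu O w x = valu O w (x / w' ^ n * w' ^ n) by rewrite divfK ?expfz_neq0.
rewrite (valM dw) ?expfz_neq0 // (val_unit dw U) add0r (valXz dw) //.
by rewrite valu_unif // mulr1.
Qed.

Lemma dvr_val1 w' : valu O w w' = 1 -> w' != 0 -> dvr O w'.
Proof.
move=> v1 w'0; have [wO w0 wV wu [fr sep]] := dw.
have := valP dw w'0; rewrite v1 expr1z => /and3P[_ uO uV].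
have w'E : w' = w * (w' / w) by rewrite mulrC divfK.
split=> //.
- by rewrite w'E rpredM.
- apply: contra wV => w'V; have -> : w^-1 = w' / w / w' by field; rewrite ?w0 ?w'0.
  exact: rpredM.
- move=> x /wu[]; [by left | right].
  by have -> : x / w' = x / w * (w' / w)^-1; [field; rewrite ?w0 ?w'0 | exact: rpredM].
split=> // x xO x0; have [n xn] := sep x xO x0; exists n.
apply: contra xn => xn; have -> : x / w ^+ n = x / w' ^+ n * (w' / w) ^+ n.
  by rewrite exprMn exprVn; field; rewrite !expf_neq0.
by apply: rpredM => //; apply: rpredX.
Qed.

End IndexInDvr.

(** The uniformiser divides p, so wO contains pO, whose index is finite by [index_p]; powers of w
    and units give the rest. *)
Lemma index_zint p (p_pr : prime p) (F : fieldExtType (padic p_pr)) w c :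
    uniformiser (@ring_of_integers _ p_pr F) w -> c != 0 -> c \in zint F ->
  exists N, has_index (fun x => x \in zint F) (fun x => x / c \in zint F) N.
Proof.
move=> wu; apply: (index_dvr (zint_dvr wu)); have [y yO py] := p_multiple wu.
have p0 := p_neq0 F; apply: index_finite (index_p wu).
  exact: subgroup_mulO.
move=> x; have w0 : w != 0 by apply: contraNneq p0 => w0; rewrite py w0 mul0r.
have y0 : y != 0 by apply: contraNneq p0 => y0; rewrite py y0 mulr0.
move=> xp; have -> : x / w = x / p%:R * y by rewrite py; field; rewrite w0 y0.
exact: rpredM.
Qed.

(** * The integers of L, compared with those of K and acted on by the Galois group *)

Section BaseField.
Variables (p : nat) (p_pr : prime p) (K : fieldExtType (padic p_pr)).
Variable L : splittingFieldType K.

(* OL as a predicate on L itself, where it is a subring. *)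
Definition lint : {pred L} := zint (baseFieldType L).

Fact lint_subring : subring_closed lint.
Proof. exact: (@zint_subring _ _ (baseFieldType L)). Qed.
HB.instance Definition _ := GRing.isSubringClosed.Build L lint lint_subring.

Lemma lint_dvr w : uniformiser (OL L) w -> dvr lint w.
Proof. exact: (@zint_dvr _ _ (baseFieldType L)). Qed.

Lemma dvr_OL w : dvr lint w -> uniformiser (OL L) w.
Proof. exact: (@dvr_uniformiser _ _ (baseFieldType L)). Qed.

Lemma OLE x : OL L x = (x \in lint) :> Prop.
Proof. exact: (@ring_of_integersE _ _ (baseFieldType L)). Qed.

Lemma unit_OLE x : unit_of (OL L) x <-> unit_in lint x.
Proof. exact: (@unit_ofE _ _ (baseFieldType L)). Qed.

Lemma zp_in_base z : zp_in (baseFieldType L) z = (zp_in K z)%:A :> L.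
Proof. by rewrite /zp_in /= baseField_scaleE. Qed.

Lemma lint_alg (a : K) : (a%:A \in lint) = (a \in zint K).
Proof.
have mapE f : map_poly (zp_in (baseFieldType L)) f
    = map_poly (in_alg L) (map_poly (zp_in K) f).
  by rewrite -map_poly_comp; apply: eq_map_poly => z; exact: zp_in_base.
apply/zintP/zintP => -[f f_mon fa]; exists f => //.
  by move: fa; rewrite mapE -in_algE fmorph_root.
by rewrite mapE -[a%:A]in_algE fmorph_root.
Qed.

Lemma lint_gal (g : gal_of {:L}) x : (g x \in lint) = (x \in lint).
Proof.
suff {x} H (h : gal_of {:L}) x : x \in lint -> h x \in lint.
  apply/idP/idP; last exact: H.
  by move/(H g^-1%g); rewrite -galM ?memvf // mulgV gal_id.
move=> /zintP[f f_mon fa]; apply/zintP; exists f => //.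
have -> : map_poly (zp_in (baseFieldType L)) f
    = map_poly h (map_poly (zp_in (baseFieldType L)) f).
  rewrite -map_poly_comp; apply: eq_map_poly => z /=.
  by rewrite zp_in_base linearZ /= rmorph1.
exact: rmorph_root.
Qed.

End BaseField.

Arguments lint {p p_pr K} L.

(** * Totally ramified extensions of degree p *)

Section TotallyRamified.
Variables (p : nat) (p_pr : prime p) (K : fieldExtType (padic p_pr)).
Variables (L : splittingFieldType K) (wK : K) (wL : L).
Hypotheses (dwK : dvr (zint K) wK) (dwL : dvr (lint L) wL).
Local Notation vL := (valu (lint L) wL).
Local Notation vK := (valu (zint K) wK).

Lemma unit_in_alg (a : K) : unit_in (lint L) a%:A = unit_in (zint K) a.
Proof.
by rewrite /unit_in -!in_algE fmorph_eq0 -fmorphV !in_algE !lint_alg.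
Qed.

Lemma unit_in_gal (g : gal_of {:L}) x : unit_in (lint L) (g x) = unit_in (lint L) x.
Proof. by rewrite /unit_in fmorph_eq0 -fmorphV !lint_gal. Qed.

(** Applying [g] multiplies all valuations by v(g w). Both v(g w) and v(g^-1 w) are positive, and
    their product is v(w) = 1. *)
Lemma val_gal (g : gal_of {:L}) x : vL (g x) = vL x.
Proof.
have [_ w0 wV _ _] := dwL.
have valg h y : y != 0 -> vL ((h : gal_of {:L}) y) = vL y * vL (h wL).
  move=> y0; have U := valP dwL y0; have /and3P[u0 _ _] := U.
  rewrite -{1}(divfK (expfz_neq0 (vL y) w0) y) rmorphM rmorphXz ?unitfE //.
  rewrite (valM dwL) ?expfz_neq0 ?fmorph_eq0 // (valXz dwL) ?fmorph_eq0 //.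
  by rewrite (val_unit dwL) ?unit_in_gal // add0r.
have gw_ge h : 1 <= vL ((h : gal_of {:L}) wL).
  have gw0 : h wL != 0 by rewrite fmorph_eq0.
  have : vge (lint L) wL 0 (h wL) by rewrite (vge0E dwL) lint_gal; case: dwL.
  rewrite /vge (negPf gw0) /= le_eqVlt => /orP[/eqP/esym/(val_unitE dwL gw0)|//].
  by rewrite unit_in_gal => /and3P[_ _]; rewrite (negPf wV).
have [->|x0] := eqVneq x 0; first by rewrite rmorph0.
have : 1 = vL (g^-1%g wL) * vL (g wL).
  by rewrite -valg ?fmorph_eq0 // -galM ?memvf // mulVg gal_id (valw dwL).
rewrite (valg g x x0) => e; suff -> : vL (g wL) = 1 by rewrite mulr1.
have := gw_ge g; have := gw_ge g^-1%g; nia.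
Qed.

Lemma val_alg (a : K) : vL a%:A = vL wK%:A * vK a.
Proof.
have [->|a0] := eqVneq a 0; first by rewrite scale0r !valu0 mulr0.
have [_ wK0 _ _ _] := dwK; have wK0' : wK%:A != 0 :> L by rewrite -in_algE fmorph_eq0.
have U := valP dwK a0; have /and3P[u0 _ _] := U.
rewrite -{1}(divfK (expfz_neq0 (vK a) wK0) a) -in_algE rmorphM rmorphXz ?unitfE //.
rewrite (valM dwL) ?expfz_neq0 ?fmorph_eq0 //= (valXz dwL) //.
have -> : vL (a / wK ^ vK a)%:A = 0 by rewrite (val_unit dwL) ?unit_in_alg.
by rewrite add0r mulrC.
Qed.

(** The norm of w_L lies in K and has valuation p, so the ramification index divides the prime p. *)
Lemma ramification_eq_degree : galois 1 {:L} -> \dim {:L} = p ->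
  1 < vL wK%:A -> vL wK%:A = p.
Proof.
move=> galLK degLK e_gt1; have [_ w0 _ _ _] := dwL.
have cardG : #|'Gal({:L} / 1)%g| = p by rewrite -galois_dim // dimv1 divn1.
pose N := galNorm 1 {:L} wL.
have : N \in 1%VS.
  have /galois_fixedField <- := galLK.
  exact/galNorm_fixedField/memvf.
case/vlineP=> a Na.
have NE : vL N = #|'Gal({:L} / 1)%g|.
  rewrite -natz -sumr_const /N /galNorm.
  suff [] : \prod_(g in 'Gal({:L} / 1)%g) g wL != 0 /\
    vL (\prod_(g in 'Gal({:L} / 1)%g) g wL) = \sum_(g in 'Gal({:L} / 1)%g) 1 by [].
  elim/big_rec2: _ => [|g n x _ [x0 xn]]; first by rewrite oner_eq0 (val1 dwL).
  have gw0 : g wL != 0 by rewrite fmorph_eq0.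
  by rewrite mulf_neq0 // (valM dwL) // xn val_gal (valw dwL).
rewrite cardG in NE; have a0 : a != 0.
  apply: contra_eq_neq NE => a0; rewrite Na a0 scale0r valu0.
  by rewrite eqz_nat eq_sym -lt0n prime_gt0.
rewrite Na (val_alg a) in NE; move: e_gt1 NE.
have p_gt1 := prime_gt1 p_pr.
case: (vL wK%:A) => // e e1; case: (vK a) => [k|k].
  2: by move=> ep; have := @mulr_ge0_le0 _ e%:Z (Negz k) isT isT; rewrite ep; lia.
rewrite -PoszM => -[ep]; congr Posz; have : (e %| p)%N by rewrite -ep dvdn_mulr.
have [_ p_dvd] := primeP p_pr.
by move/p_dvd => /orP[/eqP e1'|/eqP->//]; rewrite e1' in e1.
Qed.

Hypotheses (degLK : \dim {:L} = p) (tot : vL wK%:A = p).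

Lemma val_algp (a : K) : vL a%:A = p%:Z * vK a.
Proof. by rewrite val_alg tot. Qed.

Let wL0 : wL != 0. Proof. by case: dwL. Qed.

Lemma val_scale (a : K) x : a != 0 -> x != 0 -> vL (a *: x) = p%:Z * vK a + vL x.
Proof.
move=> a0 x0; rewrite -[x]mul1r scalerAl (valM dwL) ?mul1r ?val_algp //.
by rewrite -in_algE fmorph_eq0.
Qed.

Lemma val_term (a : K) (i : nat) : a != 0 -> vL (a *: wL ^+ i) = p%:Z * vK a + i%:Z.
Proof.
by move=> a0; rewrite val_scale ?expf_neq0 // (valX dwL) // (valw dwL) mulr1.
Qed.

Lemma term_inj (a : 'I_p -> K) i j : a i *: wL ^+ i != 0 -> a j *: wL ^+ j != 0 ->
  vL (a i *: wL ^+ i) = vL (a j *: wL ^+ j) -> i = j.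
Proof.
rewrite !scaler_eq0 => /norP[ai _] /norP[aj _]; rewrite !val_term //.
move/(congr1 (fun z => (z %% p)%Z)); rewrite ![p%:Z * _]mulrC !modzMDl.
by rewrite !modz_small ?ltz_nat ?ltn_ord // => -[/val_inj].
Qed.

Lemma expand_vge n (a : 'I_p -> K) : vge (lint L) wL n (\sum_i a i *: wL ^+ i) ->
  forall i, vge (lint L) wL n (a i *: wL ^+ i).
Proof.
have [/existsP ex|] := boolP [exists i, a i *: wL ^+ i != 0]; last first.
  rewrite negb_exists => /forallP a0 _ i; have := a0 i; rewrite negbK => /eqP->.
  exact: vge0.
have [i0 [_ s0 _ H]] := val_sum_distinct dwL (@term_inj a) ex.
rewrite {1}/vge (negPf s0) /= => le i; exact: vge_trans (H i).
Qed.

Lemma expand_free (a : 'I_p -> K) : \sum_i a i *: wL ^+ i = 0 -> forall i, a i = 0.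
Proof.
move=> s0 i; have : a i *: wL ^+ i = 0.
  apply: (vge_all0 dwL) => n; apply: expand_vge; rewrite s0; exact: vge0.
by move/eqP; rewrite scaler_eq0 expf_eq0 (negPf wL0) andbF orbF => /eqP.
Qed.

Lemma expand_ex x : exists a : 'I_p -> K, x = \sum_i a i *: wL ^+ i.
Proof.
pose X := [tuple wL ^+ i | i < p].
have XE (i : 'I_p) : X`_i = wL ^+ i by rewrite -tnth_nth tnth_mktuple.
have X_free : free X.
  by apply/freeP => k k0; apply: expand_free; under eq_bigr do rewrite -XE.
have X_full : <<X>>%VS = {:L}%VS.
  apply/eqP; rewrite eqEdim subvf /= degLK.
  by have /eqP -> := X_free; rewrite size_tuple.
have := memvf x; rewrite -X_full => /coord_span xE.
by exists (fun i => coord X i x); rewrite {1}xE; apply: eq_bigr => i _; rewrite XE.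
Qed.

Lemma expand_lint (a : 'I_p -> K) :
  \sum_i a i *: wL ^+ i \in lint L <-> forall i, a i \in zint K.
Proof.
have [wLO _ _ _ _] := dwL; split=> [|aO]; last first.
  apply: rpred_sum => i _; rewrite -[wL ^+ i]mul1r scalerAl.
  by apply: rpredM; [rewrite lint_alg | exact: rpredX].
rewrite -(vge0E dwL) => /expand_vge h i; have := h i; rewrite -(vge0E dwK) /vge.
have [//|ai0 /=] := eqVneq (a i) 0.
rewrite scaler_eq0 (negPf ai0) expf_eq0 (negPf wL0) andbF /= val_term //.
apply: contraLR; rewrite -!ltNge => lt.
(* A coefficient of negative valuation would give a term of valuation at most i - p < 0. *)
have : p%:Z * vK (a i) <= p%:Z * -1 by apply: ler_wpM2l => //; rewrite -ltzD1.
rewrite -(lerD2r i%:Z) => /le_lt_trans; apply.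
by rewrite mulrN1 addrC subr_lt0 ltz_nat.
Qed.

(** K and L have the same residue field: all terms of the expansion except the constant one have
    positive valuation. *)
Lemma residue_alg x : x \in lint L ->
  exists2 a : K, a \in zint K & vge (lint L) wL 1 (x - a%:A).
Proof.
have [a ->] := expand_ex x; move/expand_lint => aO.
pose i0 := Ordinal (prime_gt0 p_pr); exists (a i0) => //.
rewrite (bigD1 i0) //= expr0 [_ + \sum_(_ | _) _]addrC addrK; apply: (vge_sum dwL) => i ii0.
rewrite /vge; have [//|] := eqVneq (a i *: _) 0.
rewrite scaler_eq0 => /norP[ai0 _] /=; rewrite val_term //.
have : vge (zint K) wK 0 (a i) by rewrite (vge0E dwK); exact: aO.
rewrite /vge (negPf ai0) /= => va; have i_gt0 : (0 < i)%N by rewrite lt0n.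
by have := mulr_ge0 (isT : 0 <= p%:Z) va; lia.
Qed.

End TotallyRamified.

Lemma zint_nat_unit p (p_pr : prime p) (F : fieldExtType (padic p_pr)) w (i : nat) :
  uniformiser (@ring_of_integers _ p_pr F) w -> (0 < i < p)%N ->
  unit_in (zint F) i%:R.
Proof.
move=> wu /andP[i0 ip]; rewrite -(rmorph_nat (zp_in F)).
apply: (zint_residue_unit wu); rewrite padic_natE residue_of_int expn1.
by rewrite modz_small ?ltz_nat //; move/eqP; rewrite eqz_nat -leqn0 leqNgt i0.
Qed.

Lemma exp1D_prime (A : comNzRingType) (S : subringClosed A) p (z : A) :
  prime p -> z \in S -> exists2 y, y \in S & (1 + z) ^+ p = 1 + z ^+ p + p%:R * y.
Proof.
case: p => // q p_pr zS; exists (\sum_(i < q) z ^+ i.+1 *+ ('C(q.+1, i.+1) %/ q.+1)).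
  by apply: rpred_sum => i _; rewrite rpredMn // rpredX.
rewrite exprDn; under eq_bigr do rewrite expr1n mul1r.
rewrite big_ord_recl big_ord_recr /= bin0 expr0 mulr1n /bump /= binn mulr1n.
rewrite addrA addrAC; congr (_ + _); rewrite mulr_sumr; apply: eq_bigr => i _.
rewrite /= add1n mulr_natl -mulrnA divnK // prime_dvd_bin //.
by have := ltn_ord i; lia.
Qed.

Lemma sum_ord_ends (V : zmodType) n q (f : nat -> V) : n = q.+2 ->
  \sum_(k < n) f k = f 0%N + \sum_(k < q) f k.+1 + f q.+1.
Proof. by move->; rewrite big_ord_recl big_ord_recr addrA. Qed.

(** * The ramification jump *)

Section Jump.
Variables (p : nat) (p_pr : prime p) (K : fieldExtType (padic p_pr)).
Variables (L : splittingFieldType K) (wK : K) (wL : L).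
Hypotheses (wK_unif : uniformiser (OK K) wK) (wL_unif : uniformiser (OL L) wL).
Local Notation vL := (valu (lint L) wL).
Local Notation vK := (valu (zint K) wK).
Local Notation vgeL := (vge (lint L) wL).
Let dwK : dvr (zint K) wK. Proof. exact: zint_dvr. Qed.
Let dwL : dvr (lint L) wL. Proof. exact: lint_dvr. Qed.
Hypotheses (degLK : \dim {:L} = p) (tot : vL wK%:A = p).
Variables (g : gal_of {:L}) (t : int).
Hypotheses (g_order : forall x, iter p g x = x).
Hypotheses (t_ge0 : 0 <= t) (pt : (p %| t)%Z).
Local Notation del := (fun x => g x - x).
Hypotheses (gwL : g wL != wL) (v_del_wL : vL (g wL - wL) = t + 1).

Let p_gt1 : (1 < p)%N. Proof. exact: prime_gt1. Qed.
Let w0 : wL != 0. Proof. by case: dwL. Qed.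

Lemma lint_nat_unit (i : nat) : (0 < i < p)%N -> unit_in (lint L) i%:R.
Proof. exact: (@zint_nat_unit _ p_pr (baseFieldType L) wL _ wL_unif). Qed.

Let theta := (g wL - wL) / wL.
Let theta0 : theta != 0. Proof. by rewrite mulf_neq0 ?invr_eq0 ?subr_eq0. Qed.
Let v_theta : vL theta = t.
Proof.
by rewrite (valM dwL) ?subr_eq0 ?invr_eq0 // (valV dwL) // v_del_wL (valw dwL) addrK.
Qed.
Let gwLE : g wL = wL * (1 + theta).
Proof. by rewrite /theta mulrDr mulr1 mulrCA mulfV // mulr1 addrC subrK. Qed.

Lemma p_vgeL : vgeL 1 p%:R.
Proof.
have [y yO ->] := @p_multiple _ _ (baseFieldType L) wL wL_unif.
by rewrite mulrC; apply: (vgeMl dwL) => //; rewrite /vge (valw dwL) lexx orbT.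
Qed.

(* t = 0 is impossible: u = g(w)/w is congruent to an element of K, so that
   1 = N(u) is congruent to u^p, and u^p - 1 to (u - 1)^p. *)
Lemma jump_gt0 : 0 < t.
Proof.
rewrite lt_def t_ge0 andbT; apply/eqP => t0.
pose u := 1 + theta.
have thetaO : theta \in lint L by rewrite -(vge0E dwL) /vge v_theta t0 lexx orbT.
have uO : u \in lint L by rewrite rpredD ?rpred1.
have gO x i : x \in lint L -> iter i g x \in lint L.
  by move=> xO; elim: i => [|i IHi]; rewrite ?iterS ?lint_gal.
have giu i : vgeL 1 (iter i g u - u).
  have [a aO ua] := residue_alg dwK dwL degLK tot uO.
  have gia : iter i g a%:A = a%:A.
    by elim: i => //= i ->; rewrite linearZ /= rmorph1.
  have -> : iter i g u - u = iter i g (u - a%:A) - (u - a%:A).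
    have -> : iter i g (u - a%:A) = iter i g u - iter i g a%:A.
      by elim: i {gia} => //= i ->; rewrite rmorphB.
    by rewrite gia; ring.
  apply: (vgeB dwL) (ua); elim: i {gia} => [|i IHi]; first exact: ua.
  by rewrite iterS /vge fmorph_eq0 val_gal.
have giw i : iter i g wL = wL * \prod_(j < i) iter j g u.
  elim: i => [|i IHi]; first by rewrite big_ord0 mulr1.
  rewrite big_ord_recl [X in _ * (X * _)]/= mulrA -gwLE iterS IHi rmorphM rmorph_prod.
  by congr (_ * _).
have prod1 : \prod_(j < p) iter j g u = 1.
  by apply: (mulfI w0); rewrite -giw g_order mulr1.
have up i : vgeL 1 (\prod_(j < i) iter j g u - u ^+ i).
  elim: i => [|i IHi]; first by rewrite big_ord0 subrr vge0.
  rewrite big_ord_recr exprSr /=; set P := \prod_(_ < _) _ in IHi *.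
  have -> : P * iter i g u - u ^+ i * u =
     iter i g u * (P - u ^+ i) + u ^+ i * (iter i g u - u) by ring.
  apply: (vgeD dwL); apply: (vgeMl dwL).
  - exact: gO.
  - exact: IHi.
  - exact: rpredX.
  - exact: giu.
have [y yO] := exp1D_prime p_pr thetaO; rewrite -/u => uE.
have : vgeL 1 (theta ^+ p).
  have -> : theta ^+ p = - (\prod_(j < p) iter j g u - u ^+ p) - y * p%:R.
    by rewrite prod1 uE; ring.
  rewrite (vgeB dwL) ?(vgeN dwL) //; apply: (vgeMl dwL) => //; exact: p_vgeL.
by rewrite /vge expf_eq0 (negPf theta0) andbF (valX dwL) // v_theta t0 mulr0.
Qed.

(** The quotient ((1 + theta)^i - 1) / theta is a sum of i powers of 1 + theta, congruent to i and
    hence a unit. The congruence requires v(theta) = t > 0, which is [jump_gt0]. *)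
Lemma v_del_exp (i : nat) : (0 < i < p)%N ->
  g (wL ^+ i) - wL ^+ i != 0 /\ vL (g (wL ^+ i) - wL ^+ i) = i%:Z + t.
Proof.
move=> ip; have t_gt0 := jump_gt0; pose S := \sum_(j < i) (1 + theta) ^+ j.
have -> : g (wL ^+ i) - wL ^+ i = wL ^+ i * (theta * S).
  have := subrX1 (1 + theta) i; rewrite addrAC subrr add0r -/S => <-.
  by rewrite rmorphXn /= gwLE exprMn mulrBr mulr1.
have iU := lint_nat_unit ip; have /and3P[i0 _ _] := iU.
have [S0 vS] : S != 0 /\ vL S = 0.
  rewrite -(val_unit dwL iU); have -> : S = i%:R + (S - i%:R) by ring.
  apply: (val_add_dominant dwL) => //; rewrite (val_unit dwL iU) add0r.
  have -> : S - i%:R = \sum_(j < i) ((1 + theta) ^+ j - 1).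
    by rewrite sumrB sumr_const card_ord.
  apply: (vge_sum dwL) => j _; rewrite subrX1 addrAC subrr add0r mulrC.
  have th1 : vgeL 1 theta by rewrite /vge v_theta -gtz0_ge1 t_gt0 orbT.
  apply: (vgeMl dwL) (th1); apply: rpred_sum => k _.
  apply: rpredX; apply: rpredD; first exact: rpred1.
  by rewrite -(vge0E dwL); apply: vge_trans th1.
have thS0 : theta * S != 0 by exact: mulf_neq0.
have wi0 : wL ^+ i != 0 by exact: expf_neq0.
split; first exact: mulf_neq0.
by rewrite (valM dwL) // (valM dwL) // vS v_theta addr0 (valX dwL) // (valw dwL) mulr1.
Qed.

Lemma delZ (a : K) x : g (a *: x) - a *: x = a *: (g x - x).
Proof. by rewrite linearZ scalerBr. Qed.

Lemma delD x y : g (x + y) - (x + y) = (g x - x) + (g y - y).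
Proof. by rewrite rmorphD opprD addrACA. Qed.

Lemma del_expand (a : 'I_p -> K) :
  g (\sum_i a i *: wL ^+ i) - \sum_i a i *: wL ^+ i =
  \sum_(i < p) a i *: (g (wL ^+ i) - wL ^+ i).
Proof.
by rewrite rmorph_sum -sumrB; apply: eq_bigr => i _; rewrite -delZ.
Qed.

Let p_pos : (0 < p)%N. Proof. exact: prime_gt0. Qed.

Lemma del1 (i : 'I_p) : i = 0%N :> nat -> g (wL ^+ i) - wL ^+ i = 0.
Proof. by move=> ->; rewrite expr0 rmorph1 subrr. Qed.

Lemma v_del_term (a : K) (i : 'I_p) : a *: (g (wL ^+ i) - wL ^+ i) != 0 ->
  [/\ (0 < i)%N, a != 0 &
      vL (a *: (g (wL ^+ i) - wL ^+ i)) = p%:Z * vK a + i%:Z + t].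
Proof.
rewrite scaler_eq0 => /norP[a0 d0].
have i_gt0 : (0 < i)%N by rewrite lt0n; apply: contra_neq d0 => /del1.
have [_ vd] : g (wL ^+ i) - wL ^+ i != 0 /\ vL (g (wL ^+ i) - wL ^+ i) = i%:Z + t.
  by apply: v_del_exp; rewrite i_gt0 ltn_ord.
by split=> //; rewrite (val_scale dwK dwL tot) // vd addrA.
Qed.

Lemma vge_del n x : vgeL n x -> vgeL (n + t) (g x - x).
Proof.
have [a ->] := expand_ex dwK dwL degLK tot x.
move=> /(expand_vge dwK dwL tot) h; rewrite del_expand; apply: (vge_sum dwL) => i _.
rewrite /vge; have [//|d0 /=] := eqVneq (a i *: _) 0.
have [i0 a0 ->] := v_del_term d0; rewrite lerD2r.
have := h i; rewrite /vge scaler_eq0 expf_eq0 (negPf w0) (negPf a0) andbF /=.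
by rewrite (val_term dwK dwL tot).
Qed.

(** The constant term is killed, and as p divides t the i-th term keeps its class i modulo p with 0
    < i < p. The classes stay distinct and the class 0 never occurs. *)
Lemma del_val_ndvd x : g x - x != 0 -> ~~ (p %| vL (g x - x))%Z.
Proof.
have [a ->] := expand_ex dwK dwL degLK tot x; rewrite del_expand => d0.
have ex : exists i : 'I_p, a i *: (g (wL ^+ i) - wL ^+ i) != 0.
  apply: contra_neqP d0 => nex; apply: big1 => i _.
  by apply/eqP; apply: contra_notT nex => ?; exists i.
have inj (i j : 'I_p) : a i *: (g (wL ^+ i) - wL ^+ i) != 0 ->
    a j *: (g (wL ^+ j) - wL ^+ j) != 0 ->
    vL (a i *: (g (wL ^+ i) - wL ^+ i)) = vL (a j *: (g (wL ^+ j) - wL ^+ j)) -> i = j.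
  move=> /v_del_term[_ _ ->] /v_del_term[_ _ ->] /addIr.
  move/(congr1 (fun z => (z %% p)%Z)); rewrite ![p%:Z * _]mulrC !modzMDl.
  by rewrite !modz_small ?ltz_nat ?ltn_ord // => -[/val_inj].
have [i [di _ -> _]] := val_sum_distinct dwL inj ex.
have [i0 _ ->] := v_del_term di.
rewrite rpredDr // rpredDl; last exact: dvdz_mulr.
by rewrite dvdzE /= gtnNdvd.
Qed.

(** The leading term of x has index i > 0 because p does not divide v(x), so [v_del_exp] computes
    its image; [vge_del] pushes the remaining terms beyond it. *)
Lemma v_del x : x != 0 -> ~~ (p %| vL x)%Z ->
  g x - x != 0 /\ vL (g x - x) = vL x + t.
Proof.
have [a xE] := expand_ex dwK dwL degLK tot x => x0 px.
have vx : vgeL (vL x) (\sum_i a i *: wL ^+ i) by rewrite -xE vge_val.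
have h := expand_vge dwK dwL tot vx.
have [i [ai0 vi]] : exists i : 'I_p, a i != 0 /\ p%:Z * vK (a i) + i%:Z = vL x.
  have ex : exists i : 'I_p, a i *: wL ^+ i != 0.
    apply: contra_neqP x0 => nex; rewrite xE; apply: big1 => i _.
    by apply/eqP; apply: contra_notT nex => ?; exists i.
  have inj (i j : 'I_p) : a i *: wL ^+ i != 0 -> a j *: wL ^+ j != 0 ->
      vL (a i *: wL ^+ i) = vL (a j *: wL ^+ j) -> i = j.
    exact: (term_inj dwK dwL tot).
  have [i [di _ vs _]] := val_sum_distinct dwL inj ex.
  exists i; move: di vs; rewrite -xE scaler_eq0 => /norP[a0 _] ->; split=> //.
  by rewrite (val_term dwK dwL tot).
have i_gt0 : (0 < i)%N.
  by rewrite lt0n; apply: contraNneq px => i0; rewrite -vi i0 addr0 dvdz_mulr.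
have rest : vgeL (vL x + 1) (x - a i *: wL ^+ i).
  rewrite {2}xE (bigD1 i) //= [_ + \sum_(_ | _) _]addrC addrK.
  apply: (vge_sum dwL) => j ji; have := h j; rewrite /vge.
  have [//|dj /=] := eqVneq (a j *: _) 0; rewrite le_eqVlt => /orP[/eqP e|].
    have di : a i *: wL ^+ i != 0 by rewrite scaler_eq0 negb_or ai0 expf_neq0.
    case/eqP: ji; apply: (term_inj dwK dwL tot dj di).
    by rewrite -e (val_term dwK dwL tot).
  by rewrite lezD1.
have ip : (0 < i < p)%N by rewrite i_gt0 ltn_ord.
have [d0 vd] := v_del_exp ip.
pose y := x - a i *: wL ^+ i.
have -> : g x - x = a i *: (g (wL ^+ i) - wL ^+ i) + (g y - y).
  by rewrite -delZ -delD /y [_ + (x - _)]addrC subrK.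
have vt : vL (a i *: (g (wL ^+ i) - wL ^+ i)) = vL x + t.
  by rewrite (val_scale dwK dwL tot) // vd addrA vi.
rewrite -vt; apply: (val_add_dominant dwL); first by rewrite scaler_eq0 negb_or ai0.
by rewrite vt addrAC; exact: vge_del.
Qed.

(** The binomial theorem for the operator g = 1 + [del]. *)
Lemma iter_del (n : nat) y :
  iter n g y = \sum_(k < n.+1) iter k del y *+ 'C(n, k).
Proof.
elim: n => [|n IHn]; first by rewrite big_ord1.
rewrite iterS {}IHn rmorph_sum /= [RHS]big_ord_recl /= bin0.
have -> : \sum_(i < n.+1) iter (bump 0 i) del y *+ 'C(n.+1, bump 0 i) =
    \sum_(i < n.+1) iter i.+1 del y *+ 'C(n, i.+1) + \sum_(i < n.+1) iter i.+1 del y *+ 'C(n, i).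
  by rewrite -big_split; apply: eq_bigr => i _; rewrite /bump add1n binS mulrnDr.
have -> : y *+ 1 + (\sum_(i < n.+1) iter i.+1 del y *+ 'C(n, i.+1) +
     \sum_(i < n.+1) iter i.+1 del y *+ 'C(n, i)) =
   \sum_(i < n.+1) iter i del y *+ 'C(n, i) + \sum_(i < n.+1) iter i.+1 del y *+ 'C(n, i).
  rewrite addrA; congr (_ + _).
  transitivity (\sum_(i < n.+2) iter i del y *+ 'C(n, i)).
    by rewrite [RHS]big_ord_recl /= bin0.
  by rewrite big_ord_recr /= bin_small // mulr0n addr0.
rewrite -big_split; apply: eq_bigr => i _ /=.
by rewrite rmorphMn -mulrnDl addrC subrK.
Qed.

(** D k is [del] applied k + 1 times to w; this shift explains the binomial coefficients C(p, k+1)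
    below. *)
Let D k := iter k del (g wL - wL).

Lemma del_relation : \sum_(k < p) D k *+ 'C(p, k.+1) = 0.
Proof.
have := iter_del p wL; rewrite g_order big_ord_recl /= bin0 mulr1n.
move/eqP; rewrite -subr_eq0 opprD addrA subrr sub0r oppr_eq0 => /eqP e.
by rewrite -[RHS]e; apply: eq_bigr => i _; rewrite /D -iterSr.
Qed.

(** All these valuations are congruent to 1 modulo p, because p divides t, so [v_del] applies at
    each step. *)
Lemma v_iter_del k : D k != 0 /\ vL (D k) = t + 1 + k%:Z * t.
Proof.
elim: k => [|k [Dk0 vk]]; first by rewrite /D /= subr_eq0 gwL v_del_wL mul0r addr0.
have [||d0 vd] := @v_del (D k) => //.
  rewrite vk rpredDr; last exact: dvdz_mull.
  by rewrite rpredDl // dvdz1 /= neq_ltn p_gt1 orbT.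
by rewrite /D iterS; split=> //; rewrite vd vk -[k.+1]addn1 PoszD mulrDl mul1r addrA.
Qed.

Lemma bin_p_mul k : (0 < k < p)%N -> exists m, 'C(p, k) = (p * m)%N.
Proof.
by move/(prime_dvd_bin p_pr)/dvdnP => [m ->]; exists m; rewrite mulnC.
Qed.

Lemma vge_bin k n x : (0 < k < p)%N -> vgeL n x -> vgeL (vL p%:R + n) (x *+ 'C(p, k)).
Proof.
move=> /bin_p_mul[m ->] xn; rewrite mulrnA -[_ *+ m]mulr_natl.
apply: (vgeMl dwL); first exact: rpred_nat.
by rewrite -[x *+ p]mulr_natl; apply: (vgeM dwL) xn; apply: vge_val.
Qed.

(* In [del_relation] the terms k = 0 and k = p - 1 have strictly smaller valuation
   than the others, so these two must have the same valuation. *)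
Lemma jump_eq : vL p%:R = p.-1%:Z * t.
Proof.
have p0 : p%:R != 0 :> L := p_neq0 (baseFieldType L).
have rel := del_relation; have t_gt0 := jump_gt0.
have [q pE] : exists q, p = q.+2.
  by exists p.-2; case: (p) p_gt1 => [|[]].
have q1E : p.-1 = q.+1 by rewrite pE.
have vP1 : 1 <= vL p%:R by have := p_vgeL; rewrite /vge (negPf p0).
have [D00 vD0] := v_iter_del 0; rewrite mul0r addr0 in vD0.
have [Dq0 vDq] := v_iter_del q.+1.
have cpp : 'C(p, q.+2) = 1%N by rewrite -pE binn.
move: rel; rewrite (sum_ord_ends (fun k => D k *+ 'C(p, k.+1)) pE) bin1 cpp mulr1n.
rewrite -[D 0 *+ p]mulr_natl; set M := \sum_(_ < _) _.
(* A middle term has the factor p of its binomial coefficient and at least one more [del] than D 0,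
   so it lies beyond p D 0 by at least t > 0. *)
have vM : vgeL (t + 1 + vL p%:R + t) M.
  apply: (vge_sum dwL) => k _; have [_ vk] := v_iter_del k.+1.
  have kp : (0 < k.+2 < p)%N by rewrite pE !ltnS ltn_ord.
  apply: vge_trans (vge_bin kp (vge_val _ _ _)); rewrite vk.
  by rewrite [leRHS]addrA [_ + (t + 1)]addrC lerD2l ler_peMl.
have vx : vL (p%:R * D 0) = t + 1 + vL p%:R by rewrite (valM dwL p0 D00) vD0 addrC.
have x0 : p%:R * D 0 != 0 by rewrite mulf_neq0.
case: (ltgtP (vL p%:R) (q.+1%:Z * t)) => [lt|gt|->]; last by rewrite q1E.
- have [] := val_add_dominant dwL x0 (y := M + D q.+1).
    rewrite vx; apply: (vgeD dwL).
      by apply: vge_trans vM; rewrite lerD2l -gtz0_ge1.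
    by rewrite /vge vDq -[leLHS]addrA lerD2l lezD1 lt orbT.
  by rewrite addrA => + _ => /eqP.
have [] := val_add_dominant dwL Dq0 (y := p%:R * D 0 + M).
  have gt' : t + 1 + q.+1%:Z * t + 1 <= t + 1 + vL p%:R.
    by rewrite -[leLHS]addrA lerD2l lezD1.
  rewrite vDq; apply: (vgeD dwL); first by rewrite /vge vx gt' orbT.
  by apply: vge_trans vM; apply: le_trans gt' _; rewrite lerDl.
by rewrite addrC => + _ => /eqP.
Qed.

Lemma valK_p : exists s : int, [/\ 0 < s, t = p%:Z * s & vK p%:R = p.-1%:Z * s].
Proof.
have /dvdzP[s tE] := pt; exists s; have p0 : p%:Z != 0 by rewrite eqz_nat -lt0n.
have t0 := jump_gt0; split; first 1 last.
- by rewrite mulrC.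
- apply: (mulfI p0); rewrite -(val_algp dwK dwL tot) -in_algE rmorph_nat jump_eq.
  by rewrite tE mulrA [LHS]mulrC.
by move: t0; rewrite tE pmulr_lgt0 // ltz_nat.
Qed.

(* On the leading terms del acts as multiplication by c = w_K^s y0, s = t / p, so
   that [del_relation] makes y0 a simple root modulo w_K of
   G(Y) = w_K^(- s (p - 1)) * sum_k C(p, k+1) (w_K^s Y)^k; and if y is a root of G
   in O_K then (1 + w_K^s y)^p = 1. *)
Lemma zeta_exists : exists2 z : K, z ^+ p = 1 & z != 1.
Proof.
have [s [s0 tE vKp]] := valK_p; have t0 := jump_gt0.
have [q pE] : exists q, p = q.+2.
  by exists p.-2; case: (p) p_gt1 => [|[]].
have q1E : p.-1 = q.+1 by rewrite pE.
have [_ wK0 _ _ _] := dwK.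
pose W : K := wK ^ s; have W0 : W != 0 by exact: expfz_neq0.
have vKW : vK W = s by rewrite (valXz dwK) // (valw dwK) mulr1.
have W0' : W%:A != 0 :> L by rewrite -in_algE fmorph_eq0.
have vW : vL W%:A = t by rewrite (val_algp dwK dwL tot) vKW tE.
have [x xE] : exists x, D 0 = x by exists (D 0).
have [x0 vx] := v_iter_del 0; rewrite mul0r addr0 xE in x0 vx.
have [d0 vd] := v_iter_del 1; rewrite mul1r in vd.
have dE : D 1 = g x - x by rewrite -xE.
have Wx0 : W%:A * x != 0 by exact: mulf_neq0.
(* The unit u measures how [del] differs from multiplication by w_K^s on x; since the residue fields
   agree, its class has a representative y0 in O_K. *)
pose u := D 1 / (W%:A * x).
have u0 : u != 0 by rewrite mulf_neq0 ?invr_eq0.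
have vu : vL u = 0.
  by rewrite (valM dwL) ?invr_eq0 // (valV dwL) // (valM dwL) // vd vW vx; ring.
have uO : u \in lint L by rewrite -(vge0E dwL) /vge vu lexx orbT.
have [y0 y0O uy] := residue_alg dwK dwL degLK tot uO.
have [y00 vy0] : y0%:A != 0 :> L /\ vL y0%:A = 0.
  have -> : y0%:A = u + (y0%:A - u) by rewrite addrC subrK.
  rewrite -vu; apply: (val_add_dominant dwL u0); rewrite vu add0r -(vgeN dwL) opprB.
  exact: uy.
pose c : K := W * y0.
have cE : c%:A = W%:A * y0%:A :> L by rewrite -!in_algE rmorphM.
have c0' : c%:A != 0 :> L by rewrite cE mulf_neq0.
have vc : vL c%:A = t by rewrite cE (valM dwL W0' y00) vW vy0 addr0.
have c1 : vgeL (t + 1 + t + 1) (g x - x - c *: x).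
  have -> : g x - x - c *: x = W%:A * x * (u - y0%:A).
    rewrite -dE /u mulrBr mulrCA mulfV // mulr1; congr (_ - _).
    by rewrite -[c *: x]mulr_algl cE mulrAC.
  apply: (vgeM dwL) uy; rewrite /vge (valM dwL) // vW vx.
  by rewrite addrC lexx orbT.
(* The replacement of D k by c^k x keeps one unit of extra precision: [del] raises the old error by
   t, and the new error is c^k times the error of the first step. *)
have ck k : vgeL (t + 1 + k%:Z * t + 1) (D k - c ^+ k *: x).
  elim: k => [|k IHk]; first by rewrite expr0 scale1r xE subrr vge0.
  have -> : D k.+1 - c ^+ k.+1 *: x =
      (g (D k - c ^+ k *: x) - (D k - c ^+ k *: x)) + c ^+ k *: (g x - x - c *: x).
    have -> : D k.+1 = g (D k) - D k by [].
    have gZ : g (c ^+ k *: x) = c ^+ k *: g x by rewrite linearZ.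
    rewrite rmorphB /= gZ exprSr -scalerA !scalerBr.
    by move: (g (D k)) (D k) (c ^+ k *: g x) (c ^+ k *: (c *: x)) (c ^+ k *: x) => *; ring.
  rewrite -[k.+1]addn1 PoszD mulrDl mul1r; apply: (vgeD dwL).
    have -> : t + 1 + (k%:Z * t + t) + 1 = t + 1 + k%:Z * t + 1 + t by ring.
    exact: vge_del.
  have -> : t + 1 + (k%:Z * t + t) + 1 = k%:Z * t + (t + 1 + t + 1) by ring.
  rewrite -mulr_algl; apply: (vgeM dwL) c1.
  rewrite -[_%:A]in_algE rmorphXn /= /vge (valX dwL _ c0') vc.
  by rewrite lexx orbT.
pose S : K := \sum_(k < p) c ^+ k *+ 'C(p, k.+1).
(* For k < p - 1 the binomial coefficient contributes v(p) = (p-1) t, which brings the error up to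
   the order of that of the last term. *)
have vS : vgeL (t + 1 + q.+1%:Z * t + 1) (S *: x).
  have -> : S *: x = - \sum_(k < p) (D k - c ^+ k *: x) *+ 'C(p, k.+1).
    under [in RHS]eq_bigr do rewrite mulrnBl.
    rewrite sumrB del_relation sub0r opprK scaler_suml.
    by apply: eq_bigr => k _; rewrite scalerMnl.
  rewrite (vgeN dwL); apply: (vge_sum dwL) => k _.
  have [kp|kp] := ltnP k.+1 p.
    apply: vge_trans (vge_bin _ (ck k)); last by rewrite kp.
    rewrite jump_eq q1E addrA lerD2r addrA [t + 1 + _]addrC lerDl.
    by rewrite mulr_ge0 // ltW.
  have kE : k = q.+1 :> nat.
    by apply/eqP; rewrite eqn_leq -ltnS -pE ltn_ord -ltnS -pE.
  by rewrite kE -[in 'C(_, _)]pE binn mulr1n; exact: ck.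
(* Elements of K have valuation in p Z inside L, so an excess of 1 there is a full unit of excess in
   K. *)
have vKS : vge (zint K) wK (q.+1%:Z * s + 1) S.
  rewrite /vge; have [//|S0 /=] := eqVneq S 0.
  move: vS; rewrite /vge scaler_eq0 (negPf S0) (negPf x0) /=.
  rewrite (val_scale dwK dwL tot S0 x0) vx -[leLHS]addrA [leLHS]addrC lerD2r.
  by rewrite !lezD1 tE mulrCA ltr_pM2l // ltz_nat.
have y0U : unit_in (zint K) y0 by rewrite -(unit_in_alg L); apply: (val_unitE dwL).
pose e0 : K := p%:R / W ^+ q.+1; have Wq0 : W ^+ q.+1 != 0 by exact: expf_neq0.
have pK0 : p%:R != 0 :> K := p_neq0 K.
have e0O : e0 \in zint K.
  rewrite -(vge0E dwK) /vge (valM dwK) ?invr_eq0 // (valV dwK) // (valX dwK _ W0).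
  by rewrite vKp vKW q1E subrr lexx orbT.
have WO : W \in zint K by rewrite -(vge0E dwK) /vge vKW ltW ?orbT.
pose m k := ('C(p, k.+2) %/ p)%N.
pose H : {poly K} := \sum_(k < q) (e0 * (m k)%:R * W ^+ k)%:P * 'X^(k.+1).
(* Here e0 = p / W^(p-1) is a unit by [valK_p]. The middle terms retain a factor W, so G is Y^(p-1)
   + e0 modulo w_K. *)
pose G : {poly K} := 'X^(q.+1) + W%:P * H + e0%:P.
have HO : H \is a polyOver (zint K).
  apply: rpred_sum => k _; apply: rpredM; last by rewrite rpredX ?polyOverX.
  rewrite polyOverC; apply: rpredM; last exact: rpredX.
  by apply: rpredM => //; exact: rpred_nat.
have GO : G \is a polyOver (zint K).
  by rewrite !rpredD ?rpredX ?polyOverX ?polyOverC // rpredM // polyOverC.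
have GE z : G.[z] * W ^+ q.+1 = \sum_(k < p) (W * z) ^+ k *+ 'C(p, k.+1).
  rewrite (sum_ord_ends (fun k => (W * z) ^+ k *+ 'C(p, k.+1)) pE) expr0 bin1.
  rewrite -[in 'C(_, q.+2)]pE binn mulr1n /G !hornerE !mulrDl.
  have pWE : p%:R = e0 * W ^+ q.+1 by rewrite divfK.
  have -> : W * H.[z] * W ^+ q.+1 = \sum_(k < q) (W * z) ^+ k.+1 *+ 'C(p, k.+2).
    rewrite horner_sum mulr_sumr mulr_suml; apply: eq_bigr => k _.
    have kp : (0 < k.+2 < p)%N by rewrite pE !ltnS ltn_ord.
    have -> : 'C(p, k.+2) = (m k * p)%N by rewrite divnK // prime_dvd_bin.
    rewrite hornerM hornerC hornerXn -[_ *+ (m k * p)]mulr_natl natrM pWE exprMn [W ^+ k.+1]exprS.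
    by move: (W ^+ q.+1) (W ^+ k) (z ^+ k.+1) => *; ring.
  by rewrite pWE exprMn; ring.
have Gy0 : vge (zint K) wK 1 G.[y0].
  have -> : G.[y0] = S / W ^+ q.+1 by rewrite /S -GE mulfK.
  apply: vge_trans (vgeM dwK vKS (vge_val _ _ _)).
  by rewrite (valV dwK) // (valX dwK _ W0) vKW addrAC subrr.
(* Modulo w_K the derivative at y0 is (p-1) y0^(p-2), a product of units. *)
have G'y0 : unit_in (zint K) G^`().[y0].
  have -> : G^`().[y0] = q.+1%:R * y0 ^+ q + W * H^`().[y0].
    rewrite /G !derivD derivC addr0 derivXn derivM derivC mul0r add0r.
    by rewrite !hornerE hornerMn hornerXn mulr_natl.
  have aU : unit_in (zint K) (q.+1%:R * y0 ^+ q).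
    apply: unit_inM (unit_inX _ y0U); apply: (zint_nat_unit wK_unif).
    by rewrite pE /= ltnSn.
  have [a0 _ _] := and3P aU.
  have [|n0 vn] := val_add_dominant dwK a0 (y := W * H^`().[y0]).
    rewrite (val_unit dwK aU) add0r mulrC; apply: (vgeMl dwK).
      by rewrite rpred_horner // polyOver_deriv.
    by rewrite /vge vKW -gtz0_ge1 s0 orbT.
  by apply: (val_unitE dwK n0); rewrite vn (val_unit dwK aU).
have [y yO [Gy yy0]] := hensel dwK (zint_complete wK_unif) GO y0O Gy0 G'y0.
have y0' : y != 0.
  apply: contraTneq yy0 => ->; rewrite sub0r (vgeN dwK) /vge (val_unit dwK y0U).
  by case/and3P: y0U => /negPf->.
exists (1 + W * y); last by rewrite -subr_eq0 addrAC subrr add0r mulf_neq0.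
rewrite exprDn big_ord_recl bin0 mulr1n subn0 expr1n expr0 mul1r.
rewrite -[RHS]addr0; congr (_ + _).
transitivity (W * y * (G.[y] * W ^+ q.+1)); last by rewrite (rootP Gy) mul0r mulr0.
rewrite GE mulr_sumr; apply: eq_bigr => k _.
by rewrite expr1n mul1r /= /bump add1n exprS mulrnAr.
Qed.

End Jump.

Lemma prime_primitive_root (F : fieldType) p (z : F) :
  prime p -> z ^+ p = 1 -> z != 1 -> p.-primitive_root z.
Proof.
move=> p_pr zp z1; have [m zm] := prim_order_exists (prime_gt0 p_pr) zp.
have [_ pd] := primeP p_pr; move/pd => /orP[/eqP m1|/eqP <-//].
by move: z1; rewrite -(prim_expr_order zm) m1 expr1 eqxx.
Qed.

Lemma sum_root_powers (F : fieldType) p (z : F) :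
  z ^+ p = 1 -> z != 1 -> \sum_(i < p) z ^+ i = 0.
Proof.
move=> zp z1; apply: (mulfI (x := z - 1)); first by rewrite subr_eq0.
by rewrite -subrX1 zp subrr mulr0.
Qed.

(** * Kummer theory: a uniformiser whose p-th power lies in K *)

Section Kummer.
Variables (p : nat) (p_pr : prime p) (K : fieldExtType (padic p_pr)).
Variables (L : splittingFieldType K) (wK : K) (wL : L).
Hypotheses (wK_unif : uniformiser (OK K) wK) (wL_unif : uniformiser (OL L) wL).
Local Notation vL := (valu (lint L) wL).
Local Notation vK := (valu (zint K) wK).
Let dwK : dvr (zint K) wK. Proof. exact: zint_dvr. Qed.
Let dwL : dvr (lint L) wL. Proof. exact: lint_dvr. Qed.
Hypotheses (degLK : \dim {:L} = p) (tot : vL wK%:A = p).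
Variables (g : gal_of {:L}) (t : int).
Hypotheses (g_order : forall x, iter p g x = x).
Hypotheses (t_ge0 : 0 <= t) (pt : (p %| t)%Z).
Hypotheses (gwL : g wL != wL) (v_del_wL : vL (g wL - wL) = t + 1).
Hypothesis g_fixed : forall x, g x = x -> exists a : K, x = a%:A.

(** The y m are the Lagrange resolvents of g w - w. Their sum is p (g w - w), so one of them is
    nonzero. *)
Lemma eigenvector (z : K) : z ^+ p = 1 -> z != 1 ->
  exists (e : K) (x : L), [/\ e ^+ p = 1, e != 1, x != 0, g x = e *: x &
    ~~ (p %| vL x)%Z].
Proof.
move=> zp z1; have z_prim := prime_primitive_root p_pr zp z1.
pose x := g wL - wL; have x0 : x != 0 by rewrite subr_eq0.
pose y m := \sum_(j < p) (z ^+ m) ^+ j *: iter j g x.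
have sum_y : \sum_(m < p) y m = p%:R *: x.
  rewrite exchange_big (bigD1 (Ordinal (prime_gt0 p_pr))) //= [X in _ + X]big1 => [|j j0].
    under eq_bigr do rewrite ?expr0 scale1r.
    by rewrite addr0 sumr_const card_ord -scaler_nat.
  rewrite -scaler_suml; under eq_bigr do rewrite exprAC.
  rewrite sum_root_powers ?scale0r // -?exprM ?[(j * p)%N]mulnC ?exprM ?zp ?expr1n //.
  rewrite -(prim_order_dvd z_prim) gtnNdvd // lt0n.
  by apply: contraNneq j0 => j0; apply/eqP/val_inj.
have [m ym0] : exists m : 'I_p, y m != 0.
  apply: contrapT => no; case/eqP: (x0).
  have /eqP : p%:R *: x = 0.
    by rewrite -sum_y big1 // => m _; apply/eqP; apply: contra_notT no => ?; exists m.
  by rewrite scaler_eq0 (negPf (p_neq0 K)) => /eqP.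
have z0 : z != 0.
  apply: contra_eq_neq zp => ->.
  by rewrite expr0n eqn0Ngt prime_gt0 // eq_sym oner_eq0.
have zm0 : z ^+ m != 0 by rewrite expf_neq0.
have zmp : (z ^+ m) ^+ p = 1 by rewrite exprAC zp expr1n.
have gy : z ^+ m *: g (y m) = y m.
  rewrite rmorph_sum scaler_sumr /=.
  under eq_bigr do rewrite linearZ /= scalerA -exprS -iterS.
  have e1 : \sum_(j < p.+1) (z ^+ m) ^+ j *: iter j g x
      = x + \sum_(j < p) (z ^+ m) ^+ j.+1 *: iter j.+1 g x.
    by rewrite big_ord_recl /= expr0 scale1r.
  have e2 : \sum_(j < p.+1) (z ^+ m) ^+ j *: iter j g x = y m + x.
    by rewrite big_ord_recr /= zmp scale1r g_order.
  by apply: (addrI x); rewrite -e1 e2 addrC.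
(* The resolvent with eigenvalue 1 is the trace of g w - w, a telescoping sum with value 0. *)
have zm1 : z ^+ m != 1.
  apply: contraNneq ym0 => zm1; rewrite /y zm1.
  under eq_bigr do rewrite expr1n scale1r.
  have giB j : iter j g x = iter j.+1 g wL - iter j g wL.
    by elim: j => // j IHj; rewrite iterS IHj rmorphB.
  under eq_bigr do rewrite giB.
  by rewrite -(big_mkord xpredT (fun j => iter j.+1 g wL - iter j g wL))
     telescope_sumr // g_order subrr.
have gyE : g (y m) = (z ^+ m)^-1 *: y m by rewrite -{2}gy scalerA mulVf // scale1r.
exists (z ^+ m)^-1, (y m); split=> //.
- by rewrite exprVn zmp invr1.
- by rewrite invr_eq1.
have e1 : (z ^+ m)^-1 - 1 != 0 by rewrite subr_eq0 invr_eq1.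
(* An eigenvector with eigenvalue e != 1 is [del] of its multiple by 1 / (e - 1), so [del_val_ndvd]
   controls its valuation. *)
pose v := ((z ^+ m)^-1 - 1)^-1 *: y m.
have dv : g v - v = y m.
  have -> : g v = ((z ^+ m)^-1 - 1)^-1 *: ((z ^+ m)^-1 *: y m).
    by rewrite /v linearZ /= gyE.
  rewrite /v -scalerBr; have -> : (z ^+ m)^-1 *: y m - y m = ((z ^+ m)^-1 - 1) *: y m.
    by rewrite scalerBl scale1r.
  by rewrite scalerA mulVf // scale1r.
rewrite -dv; apply: (del_val_ndvd wK_unif wL_unif degLK tot g_order t_ge0 pt gwL v_del_wL).
by rewrite dv.
Qed.

Lemma kummer_generator : exists (b : K) (r : L),
  [/\ dvr (zint K) b, dvr (lint L) r & r ^+ p = b%:A].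
Proof.
have [z zp z1] := zeta_exists wK_unif wL_unif degLK tot g_order t_ge0 pt gwL v_del_wL.
have [e [x [ep e1 x0 gx px]]] := eigenvector zp z1.
have [b xpE] : exists b : K, x ^+ p = b%:A.
  by apply: g_fixed; rewrite rmorphXn /= gx exprZn ep scale1r.
have b0 : b != 0.
  have : b%:A != 0 :> L by rewrite -xpE expf_neq0.
  by rewrite -in_algE fmorph_eq0.
have vb : vK b = vL x.
  have p0 : p%:Z != 0 by rewrite eqz_nat -lt0n prime_gt0.
  by apply: (mulfI p0); rewrite -(val_algp dwK dwL tot) -xpE (valX dwL).
have [u [v uv]] : exists u v : int, u * vL x + v * p%:Z = 1.
  have cop : coprimez (vL x) p.
    by rewrite coprimezE coprime_sym prime_coprime // -dvdzE.
  by have [[u v] /= uv] := coprimezP _ _ cop; exists u, v.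
have [_ wK0 _ _ _] := dwK.
(* The Bezout exponents serve both fields: x^p = b gives v_K(b) = v_L(x), so r has valuation 1 in L
   and its p-th power b' has valuation 1 in K. *)
pose r := x ^ u * (wK ^ v)%:A; pose b' := b ^ u * (wK ^ v) ^+ p.
have wv0 : wK ^ v != 0 by exact: expfz_neq0.
have wvA0 : (wK ^ v)%:A != 0 :> L by rewrite -in_algE fmorph_eq0.
have xu0 : x ^ u != 0 by exact: expfz_neq0.
have bu0 : b ^ u != 0 by exact: expfz_neq0.
exists b', r; split.
- apply: (dvr_val1 dwK); last by rewrite mulf_neq0 // expf_neq0.
  rewrite (valM dwK) ?expf_neq0 // (valXz dwK) // vb (valX dwK) // (valXz dwK) //.
  by rewrite (valw dwK) mulr1 [p%:Z * v]mulrC.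
- apply: (dvr_val1 dwL); last by rewrite mulf_neq0.
  rewrite (valM dwL) // (valXz dwL) // (val_algp dwK dwL tot) (valXz dwK) //.
  by rewrite (valw dwK) mulr1 [p%:Z * v]mulrC.
have -> : b'%:A = (b%:A) ^ u * ((wK ^ v)%:A) ^+ p :> L.
  by rewrite -!in_algE rmorphM rmorphXn rmorphXz ?unitfE.
rewrite /r exprMn -xpE; congr (_ * _).
by rewrite !exprnP !exprz_exp [p%:Z * u]mulrC.
Qed.

End Kummer.

(** * The index of an orbit module *)

Section OrbitIndex.
Variables (p : nat) (p_pr : prime p) (K : fieldExtType (padic p_pr)).
Variables (L : splittingFieldType K) (wK : K) (r : L).
Hypotheses (wK_unif : uniformiser (OK K) wK) (r_unif : uniformiser (OL L) r).
Let dwK : dvr (zint K) wK. Proof. exact: zint_dvr. Qed.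
Let dr : dvr (lint L) r. Proof. exact: lint_dvr. Qed.
Hypotheses (degLK : \dim {:L} = p) (tot : valu (lint L) r wK%:A = p).
Variables (g : gal_of {:L}) (z : K).
Hypotheses (zp : z ^+ p = 1) (z1 : z != 1) (gr : g r = z *: r).
Local Notation O := (zint K).
Local Notation idx c N := (has_index (fun x => x \in O) (fun x => x / c \in O) N).

Let p_gt0 : (0 < p)%N. Proof. exact: prime_gt0. Qed.
Let z_prim : p.-primitive_root z. Proof. exact: prime_primitive_root. Qed.

Definition orbit_span (a x : L) : Prop :=
  exists2 b : 'I_p -> K, (forall i, b i \in O) & x = \sum_i b i *: iter i g a.

Lemma orbit_subgroup (a : L) : subgroup_of (orbit_span a).
Proof.
split=> [|x y [b bO ->] [b' b'O ->]].
  by exists (fun=> 0) => [i|]; rewrite ?rpred0 // big1 // => i _; rewrite scale0r.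
exists (fun i => b i - b' i) => [i|]; first by apply: rpredB; [exact: bO | exact: b'O].
by rewrite -sumrB; apply: eq_bigr => i _; rewrite scalerBl.
Qed.

Lemma root_unit : unit_in O z.
Proof.
have z0 : z != 0.
  apply: contra_eq_neq zp => ->.
  by rewrite expr0n eqn0Ngt p_gt0 // eq_sym oner_eq0.
apply: (val_unitE dwK z0); have := valX dwK p z0; rewrite zp (val1 dwK).
by move/esym/eqP; rewrite mulf_eq0 eqz_nat eqn0Ngt p_gt0 => /eqP.
Qed.

Let zO i : z ^+ i \in O.
Proof. by have /and3P[_ h _] := root_unit; rewrite rpredX. Qed.

Lemma coord_ex : exists co : L -> 'I_p -> K, forall x, x = \sum_i co x i *: r ^+ i.
Proof. by have /choice[co coE] := expand_ex dwK dr degLK tot; exists co. Qed.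

Section Coordinates.
Variable co : L -> 'I_p -> K.
Hypothesis coE : forall x, x = \sum_i co x i *: r ^+ i.

Lemma co_uniq (a : 'I_p -> K) i : co (\sum_i a i *: r ^+ i) i = a i.
Proof.
apply/eqP; rewrite -subr_eq0; apply/eqP.
apply: (expand_free dwK dr tot (a := fun i => co (\sum_i a i *: r ^+ i) i - a i)).
under eq_bigr do rewrite scalerBl.
by rewrite sumrB -coE subrr.
Qed.

Lemma coB x y i : co (x - y) i = co x i - co y i.
Proof.
rewrite -(co_uniq (fun i => co x i - co y i)); congr (co _ i).
by under eq_bigr do rewrite scalerBl; rewrite sumrB -!coE.
Qed.

Lemma co_term (b : K) (k i : 'I_p) : co (b *: r ^+ k) i = if i == k then b else 0.
Proof.
rewrite -(co_uniq (fun i => if i == k then b else 0)); congr (co _ i).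
rewrite (bigD1 k) //= eqxx big1 ?addr0 // => j /negPf->; exact: scale0r.
Qed.

Lemma co_lint x : x \in lint L <-> forall i, co x i \in O.
Proof. by have := expand_lint dwK dr tot (co x); rewrite -coE. Qed.

Variable c : 'I_p -> K.
Hypotheses (cO : forall j, c j \in O).
Let om := \sum_j c j *: r ^+ j.

Lemma co_iter i j : co (iter i g om) j = c j * (z ^+ j) ^+ i.
Proof.
rewrite -(co_uniq (fun j => c j * (z ^+ j) ^+ i)); congr (co _ j).
elim: i => [|i IHi]; first by apply: eq_bigr => k _; rewrite expr0 mulr1.
rewrite iterS IHi rmorph_sum; apply: eq_bigr => k _.
by rewrite /= linearZ /= rmorphXn /= gr exprZn scalerA exprSr mulrA.
Qed.

(* M_k interpolates between OL (k = 0) and the orbit module (k = p); in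
   coordinates the latter is the set of all (c_j Q(z^j))_j. *)
Definition chain (k : nat) (x : L) : Prop := exists Q : {poly K},
  [/\ Q \is a polyOver O, (size Q <= k)%N,
      forall j, co x j - c j * Q.[z ^+ j] \in O &
      forall j : 'I_p, (j < k)%N -> co x j = c j * Q.[z ^+ j]].

Lemma chain0 x : chain 0 x <-> x \in lint L.
Proof.
rewrite co_lint; split=> [[Q [_ ]]|xO].
  rewrite leqn0 size_poly_eq0 => /eqP-> h _ j; have := h j.
  by rewrite horner0 mulr0 subr0.
exists 0; split=> [||j|//]; rewrite ?rpred0 ?size_poly0 //.
by rewrite horner0 mulr0 subr0.
Qed.

Lemma co_sum (b : 'I_p -> K) (y : 'I_p -> L) j :
  co (\sum_i b i *: y i) j = \sum_i b i * co (y i) j.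
Proof.
rewrite -(co_uniq (fun j => \sum_i b i * co (y i) j)); congr (co _ j).
under [RHS]eq_bigr do rewrite scaler_suml.
rewrite exchange_big; apply: eq_bigr => i _ /=.
by rewrite {1}(coE (y i)) scaler_sumr; apply: eq_bigr => k _; rewrite scalerA.
Qed.

(** The r^j are eigenvectors of [g] with eigenvalues z^j, so the operator sum_i b_i g^i scales the
    j-th coordinate by Q(z^j), where Q has the coefficients b_i. *)
Lemma chain_last x : chain p x <-> orbit_span om x.
Proof.
split=> [[Q [QO sQ _ xQ]] | [b bO ->]].
  exists (fun i : 'I_p => Q`_i) => [i|]; first exact: (polyOverP QO).
  rewrite [LHS]coE [RHS]coE; apply: eq_bigr => j _; congr (_ *: _).
  rewrite co_sum xQ ?ltn_ord // (horner_coef_wide _ sQ) mulr_sumr.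
  by apply: eq_bigr => i _; rewrite co_iter mulrCA.
pose Q := \poly_(i < p) (if insub i is Some i then b i else 0).
have QE y : Q.[y] = \sum_(i < p) b i * y ^+ i.
  by rewrite horner_poly; apply: eq_bigr => i _; rewrite valK.
have coQ j : co (\sum_i b i *: iter i g om) j = c j * Q.[z ^+ j].
  by rewrite co_sum QE mulr_sumr; apply: eq_bigr => i _; rewrite co_iter mulrCA.
exists Q; split=> [||j|j _]; rewrite ?coQ ?subrr ?rpred0 ?size_poly //.
apply/polyOver_poly => i ip; rewrite insubT; exact: bO.
Qed.

Lemma chain_subgroup k : subgroup_of (chain k).
Proof.
split=> [|x y [Q [QO sQ xQ xQ']] [Q' [Q'O sQ' yQ yQ']]].
  have co0 j : co 0 j = 0 by rewrite -(subrr 0) coB subrr.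
  by exists 0; split=> [||j|j _]; rewrite ?rpred0 ?size_poly0 // horner0 mulr0 co0 ?subrr ?rpred0.
exists (Q - Q'); split=> [||j|j jk].
- exact: rpredB.
- by rewrite (leq_trans (size_polyD _ _)) // size_polyN geq_max sQ.
- have -> : co (x - y) j - c j * (Q - Q').[z ^+ j] =
    (co x j - c j * Q.[z ^+ j]) - (co y j - c j * Q'.[z ^+ j]).
    by rewrite coB hornerD hornerN; ring.
  by apply: rpredB; [exact: xQ | exact: yQ].
by rewrite coB hornerD hornerN xQ' // yQ' // mulrBr.
Qed.

Let newton k : {poly K} := \prod_(i < k) ('X - (z ^+ i)%:P).

Lemma size_newton k : size (newton k) = k.+1.
Proof. by rewrite /newton size_prod_XsubC [index_enum _]unlock -enumT size_enum_ord. Qed.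

Lemma newton_monic k : newton k \is monic.
Proof. exact: monic_prod_XsubC. Qed.

Lemma newton_over k : newton k \is a polyOver O.
Proof. by apply: rpred_prod => i _; rewrite polyOverXsubC; exact: zO. Qed.

Lemma newton_root k (j : nat) : (j < k)%N -> (newton k).[z ^+ j] = 0.
Proof.
by move=> jk; rewrite /newton horner_prod (bigD1 (Ordinal jk)) //= !hornerE subrr mul0r.
Qed.

Lemma size_sub_newton k (Q : {poly K}) :
  (size Q <= k.+1)%N -> (size (Q - Q`_k *: newton k)%R <= k)%N.
Proof.
move=> sQ; apply/leq_sizeP => j; rewrite leq_eqVlt coefB coefZ => /orP[/eqP<-|kj].
  by have /monicP := newton_monic k; rewrite /lead_coef size_newton /= => ->; rewrite mulr1 subrr.
have Qj : Q`_j = 0 by rewrite nth_default // (leq_trans sQ).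
have Pj : (newton k)`_j = 0 by rewrite nth_default // size_newton.
by rewrite Qj Pj mulr0 subrr.
Qed.

(** Subtracting the right multiple of the Newton polynomial lowers the size of Q and leaves its
    values at the first k nodes unchanged. *)
Lemma chain_sub k x : chain k.+1 x -> chain k x.
Proof.
case=> Q [QO sQ xQ xQ']; have bO : Q`_k \in O by exact: (polyOverP QO).
exists (Q - Q`_k *: newton k); split.
- by rewrite rpredB // polyOverZ // newton_over.
- exact: size_sub_newton.
- move=> j; have -> : co x j - c j * (Q - Q`_k *: newton k).[z ^+ j] =
      (co x j - c j * Q.[z ^+ j]) + c j * (Q`_k * (newton k).[z ^+ j]).
    by rewrite hornerD hornerN hornerZ; ring.
  apply: rpredD; first exact: xQ.
  apply: rpredM; [exact: cO | apply: rpredM; first exact: bO].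
  by apply: rpred_horner; [exact: newton_over | exact: zO].
by move=> j jk; rewrite hornerD hornerN hornerZ newton_root // mulr0 subr0 xQ' // ltnW.
Qed.

Hypothesis c0 : forall j, c j != 0.

(** Once the coordinates below k are interpolated, only a multiple of the k-th Newton polynomial may
    be added to Q. It moves the value at coordinate k by d O, so M_k / M_(k+1) is O / d O,
    represented along r^k. *)
Lemma chain_index (k : 'I_p) N : idx (c k * (newton k).[z ^+ k]) N ->
  has_index (chain k) (chain k.+1) N.
Proof.
have Pk0 : (newton k).[z ^+ k] != 0.
  rewrite /newton horner_prod; apply/prodf_neq0 => i _; rewrite !hornerE subr_eq0.
  rewrite (eq_prim_root_expr z_prim) !modn_small ?ltn_ord //; last first.
    exact: ltn_trans (ltn_ord i) (ltn_ord k).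
  by rewrite neq_ltn ltn_ord orbT.
set d := c k * _; have d0 : d != 0 by rewrite mulf_neq0.
case=> [T [rep [cT repO repI repC]]].
exists T, (fun t => rep t *: r ^+ k); split=> // [t|s t|x].
- exists 0; split=> [||j|j jk]; rewrite ?rpred0 ?size_poly0 // horner0 mulr0 ?subr0 co_term.
    by case: eqP => _; [exact: repO | exact: rpred0].
  by case: eqP => // jk'; move: jk; rewrite jk' ltnn.
- rewrite -scalerBl => -[Q [QO sQ _ xQ]]; apply: repI.
  have xk := xQ k (ltnSn k); rewrite co_term eqxx in xk.
  (* The coordinates of the difference below k are 0 and the c j are nonzero, so Q vanishes at k
     distinct nodes; its size is at most k + 1. *)
  have QE : Q = Q`_k *: newton k.
    apply/eqP; rewrite -subr_eq0; apply/eqP.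
    apply: (@roots_geq_poly_eq0 _ _ [seq z ^+ i | i <- iota 0 k]).
    + apply/allP => y /mapP[i]; rewrite mem_iota add0n /= => ik ->.
      rewrite rootE hornerD hornerN hornerZ newton_root // mulr0 subr0.
      have ip := ltn_trans ik (ltn_ord k).
      have := xQ (Ordinal ip) (ltnW ik); rewrite co_term /=.
      case: eqP => [e|_ /esym/eqP]; first by move: ik; rewrite -e ltnn.
      by rewrite mulf_eq0 (negPf (c0 _)).
    + rewrite map_inj_in_uniq ?iota_uniq // => i j; rewrite !mem_iota !add0n /= => ik jk /eqP.
      rewrite (eq_prim_root_expr z_prim) !modn_small ?(ltn_trans _ (ltn_ord k)) //.
      by move/eqP.
    by rewrite size_map size_iota size_sub_newton.
  by rewrite xk QE hornerZ mulrCA mulfK // (polyOverP QO).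
move=> [Q [QO sQ xQ xQ']]; have [t] := repC _ (xQ k).
set b := _ / _ => bO; exists t; exists (Q + b *: newton k); split=> [||j|j jk].
- by rewrite rpredD // polyOverZ // newton_over.
- rewrite (leq_trans (size_polyD _ _)) // geq_max (leq_trans sQ) //=.
  by rewrite (leq_trans (size_scale_leq _ _)) // size_newton.
- have -> : co (x - rep t *: r ^+ k) j - c j * (Q + b *: newton k).[z ^+ j] =
    (co x j - c j * Q.[z ^+ j]) - (if j == k then rep t else 0) -
    c j * (b * (newton k).[z ^+ j]).
    rewrite coB co_term hornerD hornerZ mulrDr opprD addrA; congr (_ - _).
    exact: addrAC.
  apply: rpredB.
    by apply: rpredB; [exact: xQ | case: eqP => _; rewrite ?rpred0].
  apply: rpredM; [exact: cO | apply: rpredM; first exact: bO].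
  by apply: rpred_horner; [exact: newton_over | exact: zO].
rewrite coB co_term hornerD hornerZ; case: eqP => [->|/eqP kj].
  have -> : c k * (Q.[z ^+ k] + b * (newton k).[z ^+ k]) = c k * Q.[z ^+ k] + b * d.
    by rewrite /d; ring.
  by rewrite /b divfK //; ring.
have {}jk : (j < k)%N by rewrite ltn_neqAle kj -ltnS.
by rewrite subr0 newton_root // mulr0 addr0 xQ'.
Qed.

Lemma orbit_index_newton (N : nat -> nat) :
    (forall k : 'I_p, idx (c k * (newton k).[z ^+ k]) (N k)) ->
  has_index (fun x => x \in lint L) (orbit_span om) (\prod_(k < p) N k).
Proof.
move=> hN.
have hk k : (k <= p)%N -> has_index (chain 0) (chain k) (\prod_(i < k) N i).
  elim: k => [|k IHk] kp.
    rewrite big_ord0; apply: index1 => //; case: (chain_subgroup 0) => //.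
  rewrite big_ord_recr /=; apply: index_tower (IHk (ltnW kp)) _.
  - exact: chain_subgroup.
  - exact: chain_subgroup.
  - by elim: k {IHk kp} => // k IHk x /chain_sub/IHk.
  - by move=> x; apply: chain_sub.
  by apply: (chain_index (k := Ordinal kp)); exact: hN.
have chain0E : chain 0 = (fun x => x \in lint L).
  by apply/funext => x; apply/propext/chain0.
rewrite -chain0E; apply: eq_index (hk p (leqnn p)); last exact: chain_subgroup.
by move=> x _; apply: chain_last.
Qed.

(** Cyclotomic units: z and y = z^(j - i) are powers of each other, so z - 1 and y - 1 divide each
    other. *)
Lemma root_diff_unit i j : (i < j < p)%N -> unit_in O ((z ^+ j - z ^+ i) / (z - 1)).
Proof.
move=> /andP[ij jp]; have z10 : z - 1 != 0 by rewrite subr_eq0.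
pose y := z ^+ (j - i); have y1 : y - 1 != 0.
  rewrite subr_eq0 -(prim_order_dvd z_prim) gtnNdvd ?subn_gt0 //.
  by rewrite (leq_ltn_trans (leq_subr _ _)).
have -> : (z ^+ j - z ^+ i) / (z - 1) = z ^+ i * ((y - 1) / (z - 1)).
  by rewrite mulrA mulrBr mulr1 -exprD subnKC // ltnW.
apply: unit_inM; first exact/unit_inX/root_unit.
apply/and3P; split; first by rewrite mulf_neq0 ?invr_eq0.
  rewrite /y subrX1 mulrAC mulfV // mul1r; apply: rpred_sum => k _; exact: zO.
have y_prim : p.-primitive_root y.
  by apply: prime_primitive_root => //; [rewrite exprAC zp expr1n | rewrite -subr_eq0].
have [n zE] := prim_rootP y_prim zp.
rewrite invf_div {1}zE subrX1 mulrAC mulfV // mul1r; apply: rpred_sum => k _.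
by rewrite rpredX // zO.
Qed.

Lemma index_prod (f : nat -> K) l k :
  (forall i : 'I_k, [/\ f i != 0, f i \in O & idx (f i) l]) ->
  [/\ \prod_(i < k) f i != 0, \prod_(i < k) f i \in O &
     idx (\prod_(i < k) f i) (l ^ k)].
Proof.
elim: k => [|k IHk] h; first by rewrite big_ord0 oner_eq0 rpred1; split=> //; apply/index_unit/unit_in1.
have [|f0 fO fi] := IHk.
  by move=> i; exact: (h (widen_ord (leqnSn k) i)).
have [g0 gO gi] := h ord_max; rewrite big_ord_recr expnSr.
by split; [exact: mulf_neq0 | exact: rpredM | exact: index_mulO].
Qed.

Lemma index_root_diff l i j : (i < j < p)%N -> idx (z - 1) l ->
  [/\ z ^+ j - z ^+ i != 0, z ^+ j - z ^+ i \in O & idx (z ^+ j - z ^+ i) l].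
Proof.
move=> ij hl; have U := root_diff_unit ij; have /and3P[u0 uO _] := U.
have z10 : z - 1 != 0 by rewrite subr_eq0.
have zE : z ^+ j - z ^+ i = (z - 1) * ((z ^+ j - z ^+ i) / (z - 1)).
  by rewrite mulrC divfK.
split; first by rewrite zE mulf_neq0.
  by rewrite rpredB.
rewrite zE -[l]muln1; apply: index_mulO => //; last exact: index_unit.
by rewrite -[z]expr1 rpredB ?rpred1.
Qed.

(** The value of 1 + X + ... + X^(p-1) at 1 is p, and it is also the product of the p - 1 factors 1
    - z^i, all associated with z - 1. Uniqueness of the index compares the two computations. *)
Lemma lambda_index : exists2 l, idx (z - 1) l & (l ^ p.-1)%N = (p ^ \dim {:K})%N.
Proof.
have z10 : z - 1 != 0 by rewrite subr_eq0.
have z1O : z - 1 \in O by rewrite -[z]expr1 rpredB ?rpred1.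
have [l hl] := index_zint wK_unif z10 z1O; exists l => //.
have [_ _ hp] : [/\ \prod_(i < p.-1) (z ^+ i.+1 - z ^+ 0) != 0,
    \prod_(i < p.-1) (z ^+ i.+1 - z ^+ 0) \in O &
    idx (\prod_(i < p.-1) (z ^+ i.+1 - z ^+ 0)) (l ^ p.-1)].
  apply: (index_prod (f := fun i => z ^+ i.+1 - z ^+ 0)) => i.
  by apply: index_root_diff hl; rewrite /= -ltn_predRL.
have prodE : \prod_(i < p.-1) (1 - z ^+ i.+1) = p%:R.
  have X1 : 'X - 1 != 0 :> {poly K} by rewrite -polyC1 polyXsubC_eq0.
  have : \prod_(i < p.-1) ('X - (z ^+ i.+1)%:P) = \sum_(i < p) 'X^i.
    apply: (mulfI X1); rewrite -subrX1 -(factor_Xn_sub_1 z_prim).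
    by rewrite big_ltn // big_add1 big_mkord expr0.
  move/(congr1 (fun q => q.[1])); rewrite horner_prod horner_sum.
  under eq_bigr do rewrite !hornerE; move=> ->.
  under eq_bigr do rewrite hornerXn expr1n.
  by rewrite sumr_const card_ord.
apply: (index_uniq (subgroup_mulO O p%:R)) (index_p wK_unif).
apply: eq_index hp; last exact: subgroupO.
move=> x _; have -> : \prod_(i < p.-1) (z ^+ i.+1 - z ^+ 0) = (-1) ^+ p.-1 * p%:R.
  transitivity (\prod_(i < p.-1) (-1 * (1 - z ^+ i.+1))).
    by apply: eq_bigr => i _; rewrite mulN1r opprB expr0.
  by rewrite big_split /= prodr_const card_ord prodE.
by rewrite -signr_odd; case: odd; rewrite ?mulN1r ?mul1r // invrN mulrN rpredN.
Qed.

Lemma orbit_index l (N : nat -> nat) : idx (z - 1) l ->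
    (forall k : 'I_p, idx (c k) (N k)) ->
  has_index (fun x => x \in lint L) (orbit_span om)
    ((\prod_(k < p) N k) * \prod_(k < p) l ^ k).
Proof.
move=> hl hN; rewrite -big_split; apply: (orbit_index_newton (N := fun k => N k * l ^ k)%N) => k.
have [P0 PO hP] :
    [/\ (newton k).[z ^+ k] != 0, (newton k).[z ^+ k] \in O & idx ((newton k).[z ^+ k]) (l ^ k)].
  have -> : (newton k).[z ^+ k] = \prod_(i < k) (z ^+ k - z ^+ i).
    by rewrite /newton horner_prod; apply: eq_bigr => i _; rewrite !hornerE.
  apply: (index_prod (f := fun i => z ^+ k - z ^+ i)) => i.
  by apply: index_root_diff hl; rewrite !ltn_ord.
by apply: index_mulO.
Qed.

End Coordinates.

(** The j-th coordinate is 0 throughout the orbit module, so the elements w_K^n r^j lie in pairwise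
    distinct cosets. *)
Lemma orbit_index_oo (R : realType) (c : 'I_p -> K) j : c j = 0 ->
  add_index R (OL L) (orbit_span (\sum_i c i *: r ^+ i)) = +oo%E.
Proof.
move=> cj; have [co coE] := coord_ex; have [wKO wK0 _ _ _] := dwK.
apply: add_index_oo; first exact: orbit_subgroup.
exists (fun n => wK ^+ n *: r ^+ j); split=> [n|m n [b bO]].
  rewrite OLE (co_lint coE) => i; rewrite (co_term coE).
  by case: eqP => _; rewrite ?rpred0 ?rpredX.
rewrite -scalerBl => e.
have := co_term coE (wK ^+ m - wK ^+ n) j j; rewrite eqxx e (co_sum coE).
under eq_bigr do rewrite (co_iter coE) cj mul0r mulr0.
rewrite big1 // => /esym/eqP; rewrite subr_eq0 => /eqP/(congr1 (valu O wK)).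
by rewrite !(valX dwK) // (valw dwK) !mulr1 => -[].
Qed.

End OrbitIndex.

Lemma sum_ord_double n : ((\sum_(k < n) k).*2 = n * n.-1)%N.
Proof.
elim: n => [|n IHn]; first by rewrite big_ord0.
by rewrite big_ord_recr doubleD IHn /= -muln2 -mulnDr; case: n {IHn} => // n; lia.
Qed.

Lemma abs_degreeE p (p_pr : prime p) (K : fieldExtType (padic p_pr))
  (L : splittingFieldType K) : abs_degree L = (\dim {:L} * \dim {:K})%N.
Proof.
rewrite /abs_degree -dim_baseVspace; congr (\dim _).
apply/vspaceP => x; rewrite memvf; symmetry.
by have := mem_baseVspace {:L}%VS x => ->; exact: memvf.
Qed.

(** Squaring replaces the real exponent N / 2 by an identity between natural numbers. *)
Lemma powR_half (R : realType) (x N m : nat) : (0 < x)%N -> (m ^ 2 = x ^ N)%N ->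
  x%:R `^ (N%:R / 2) = m%:R :> R.
Proof.
move=> x0 mx; have x0' : (0 : R) < x%:R by rewrite ltr0n.
apply/eqP; rewrite -(@eqrXn2 _ 2) ?powR_ge0 ?ler0n //.
rewrite -natrX mx natrX -powR_mulrn ?powR_ge0 // -powRrM.
by rewrite divfK ?pnatr_eq0 // powR_mulrn ?ler0n.
Qed.

(** * The minimal index and the elements attaining it *)

Section OrbitMinimum.
Variables (p : nat) (p_pr : prime p) (K : fieldExtType (padic p_pr)).
Variables (L : splittingFieldType K) (wK : K) (r : L) (R : realType).
Hypotheses (wK_unif : uniformiser (OK K) wK) (r_unif : uniformiser (OL L) r).
Let dwK : dvr (zint K) wK. Proof. exact: zint_dvr. Qed.
Let dr : dvr (lint L) r. Proof. exact: lint_dvr. Qed.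
Hypotheses (degLK : \dim {:L} = p) (tot : valu (lint L) r wK%:A = p).
Variables (g : gal_of {:L}) (z : K).
Hypotheses (zp : z ^+ p = 1) (z1 : z != 1) (gr : g r = z *: r).
Hypothesis orbE : forall a : L, galois_orbit_module a = orbit_span g a.
Local Notation O := (zint K).
Local Notation idx c N := (has_index (fun x => x \in O) (fun x => x / c \in O) N).
Local Notation index_of c :=
  (add_index R (OL L) (galois_orbit_module (\sum_(i < p) c i *: r ^+ i))).

Let min_val := (p%:R `^ ((abs_degree L)%:R / 2) : R).

Lemma index_of_neq0 (c : 'I_p -> K) (N : nat -> nat) :
    (forall i, c i \in O) -> (forall i, c i != 0) -> (forall k : 'I_p, idx (c k) (N k)) ->
  index_of c = ((\prod_(k < p) N k)%:R * min_val)%:E /\ 0 < min_val.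
Proof.
move=> cO c0 hN; have [l hl lE] := lambda_index wK_unif zp z1.
(* The square of the product is l^(p (p-1)), and l^(p-1) = p^[K : Q_p] turns it into p^[L : Q_p]. *)
have I0E : min_val = (\prod_(k < p) l ^ k)%N%:R.
  apply: powR_half; first exact: prime_gt0.
  rewrite -expn_sum -expnM muln2 sum_ord_double mulnC expnM lE -expnM.
  by rewrite abs_degreeE degLK mulnC.
have l0 : (0 < l)%N by apply: index_gt0 hl; exact: rpred0.
split; last by rewrite I0E ltr0n prodn_gt0 // => k; rewrite expn_gt0 l0.
have [co coE] := coord_ex wK_unif r_unif degLK tot.
have h := orbit_index wK_unif r_unif tot zp z1 gr coE cO c0 hl hN.
rewrite I0E -natrM orbE; apply: add_indexE; first exact: orbit_subgroup.
have -> : OL L = (fun x => x \in lint L) :> (L -> Prop).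
  by apply/funext => x; rewrite OLE.
exact: h.
Qed.

Lemma index_choice (c : 'I_p -> K) : (forall i, c i \in O) -> (forall i, c i != 0) ->
  exists N : nat -> nat, forall k : 'I_p, idx (c k) (N k).
Proof.
move=> cO c0; have /choice[N hN] : forall k : nat,
  exists n, forall kp : (k < p)%N, idx (c (Ordinal kp)) n.
  move=> k; have [kp|kp] := pselect (k < p)%N; last by exists 0%N.
  have [n hn] := index_zint wK_unif (c0 (Ordinal kp)) (cO (Ordinal kp)).
  by exists n => kp'; rewrite (bool_irrelevance kp' kp).
by exists N => -[k kp]; exact: hN.
Qed.

Lemma index_of_ge (c : 'I_p -> K) : (forall i, c i \in O) -> (min_val%:E <= index_of c)%E.
Proof.
move=> cO; have [/existsP[j /eqP cj]|] := boolP [exists j, c j == 0].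
  by rewrite orbE (orbit_index_oo wK_unif r_unif degLK tot gr R cj) leey.
rewrite negb_exists => /forallP c0; have [N hN] := index_choice cO c0.
have [-> m0] := index_of_neq0 cO c0 hN; rewrite lee_fin; apply: ler_peMl; first exact: ltW.
rewrite ler1n prodn_gt0 // => k; apply: index_gt0 (hN k); exact: rpred0.
Qed.

Lemma index_of_eq (c : 'I_p -> K) : (forall i, c i \in O) ->
  index_of c = min_val%:E <-> forall i, unit_in O (c i).
Proof.
move=> cO; split=> [|cU]; last first.
  have c0 i : c i != 0 by case/and3P: (cU i).
  have [-> _] := index_of_neq0 cO c0 (fun i => index_unit (cU i)) (N := fun=> 1%N).
  by rewrite big1 // mul1r.
have [/existsP[j /eqP cj]|] := boolP [exists j, c j == 0].
  by rewrite orbE (orbit_index_oo wK_unif r_unif degLK tot gr R cj).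
rewrite negb_exists => /forallP c0; have [N hN] := index_choice cO c0.
have [-> m0] := index_of_neq0 cO c0 hN => -[e] i.
have /eqP : (\prod_(k < p) N k)%:R = 1 :> R.
  by apply: (mulIf (lt0r_neq0 m0)); rewrite e mul1r.
rewrite pnatr_eq1 (bigD1 i) //= muln_eq1 => /andP[/eqP Ni _].
by have := hN i; rewrite Ni; exact: (index1_unit (c0 i) (cO i)).
Qed.

(** The value is attained when all coordinates are 1, and [index_of_ge] covers every competitor
    because integers of L have integral coordinates. *)
Lemma minimal_indexE : minimal_index L R = min_val%:E.
Proof.
apply/eqP; rewrite eq_le; apply/andP; split.
  have cO (i : 'I_p) : (fun=> 1 : K) i \in O by exact: rpred1.
  have <- : index_of (fun=> 1) = min_val%:E.
    by apply/index_of_eq => // i; exact: unit_in1.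
  apply: ereal_inf_lbound; exists (\sum_(i < p) 1 *: r ^+ i) => //.
  rewrite OLE; apply/(expand_lint dwK dr tot (fun=> 1)) => i; exact: rpred1.
apply: le_ereal_inf_tmp => _ [a aO <-]; have [c aE] := expand_ex dwK dr degLK tot a.
rewrite aE; apply: index_of_ge; apply/(expand_lint dwK dr tot).
by rewrite -aE -OLE.
Qed.

End OrbitMinimum.

(** * The Galois group as the cyclic group of powers of one automorphism *)

Section GaloisGenerator.
Variables (p : nat) (p_pr : prime p) (K : fieldExtType (padic p_pr)).
Variable L : splittingFieldType K.
Hypotheses (galLK : galois 1 {:L}) (degLK : \dim {:L} = p).
Variables (g : gal_of {:L}).
Hypotheses (gG : g \in GalLK L) (g1 : g != 1%g).

Lemma iter_gal i x : iter i g x = (g ^+ i)%g x.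
Proof.
elim: i => [|i IHi]; first by rewrite expg0 gal_id.
by rewrite iterS IHi expgSr galM ?memvf.
Qed.

Let cardG : #|GalLK L| = p.
Proof. by rewrite /GalLK -galois_dim // dimv1 divn1. Qed.

Let order_g : #[g]%g = p.
Proof.
have [_ pd] := primeP p_pr; have := order_dvdG gG; rewrite cardG.
by move/pd => /orP[|/eqP//]; rewrite order_eq1 (negPf g1).
Qed.

Lemma gal_cycle : (GalLK L : {set gal_of {:L}}) = <[g]>%g.
Proof.
by apply/esym/eqP; rewrite eqEcard cycle_subG gG cardG -orderE order_g leqnn.
Qed.

Lemma iter_gal_order x : iter p g x = x.
Proof. by have := expg_order g; rewrite order_g iter_gal => ->; rewrite gal_id. Qed.

Lemma gal_fixed_alg x : g x = x -> exists a : K, x = a%:A.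
Proof.
move=> gx; have : x \in 1%VS.
  have /galois_fixedField <- := galLK; apply/fixedFieldP; first exact: memvf.
  move=> h; rewrite -[_ \in _]/(h \in GalLK L) gal_cycle => /cycleP[i ->].
  by rewrite -iter_gal; elim: i => //= i ->.
by case/vlineP=> a ->; exists a.
Qed.

Lemma galois_orbitE (a : L) : galois_orbit_module a = orbit_span g a.
Proof.
have sumE (f : gal_of {:L} -> L) : \sum_(h in GalLK L) f h = \sum_(i < p) f (g ^+ i)%g.
  have inj : {in 'I_p &, injective (fun i : 'I_p => (g ^+ i)%g)}.
    move=> i j _ _ /eqP; rewrite eq_expg_mod_order order_g !modn_small ?ltn_ord //.
    by move/eqP/val_inj.
  have GE : GalLK L = [set (g ^+ (i : 'I_p))%g | i in 'I_p] :> {set _}.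
    apply/esym/eqP; rewrite eqEcard (card_in_imset inj) card_ord cardG leqnn andbT.
    by apply/fintype.subsetP => _ /imsetP[i _ ->]; rewrite groupX.
  by rewrite GE big_imset.
apply/seteqP; split=> [x [c cO ->]|x [b bO ->]].
  exists (fun i : 'I_p => c (g ^+ i)%g) => [i|].
    by rewrite -ring_of_integersE; exact: cO.
  by rewrite sumE; apply: eq_bigr => i _; rewrite iter_gal.
exists (fun h => if [pick i : 'I_p | (g ^+ i)%g == h] is Some i then b i else 0).
  move=> h; rewrite /OK ring_of_integersE; case: pickP => [i _|_]; [exact: bO | exact: rpred0].
rewrite sumE; apply: eq_bigr => i _; rewrite iter_gal; case: pickP => [j|/(_ i)].
  rewrite eq_expg_mod_order order_g !modn_small ?ltn_ord //.
  by move/eqP/val_inj => ->.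
by rewrite eqxx.
Qed.

End GaloisGenerator.

(** Membership in G_i can be tested on w_L alone: the powers of w_L span O_L over O_K, and g(w^i) -
    w^i is a multiple of g w - w. *)
Lemma jump_element p (p_pr : prime p) (K : fieldExtType (padic p_pr))
    (L : splittingFieldType K) (wK : K) (wL : L) (t : int) :
    uniformiser (OK K) wK -> uniformiser (OL L) wL -> \dim {:L} = p ->
    valu (lint L) wL wK%:A = p -> ramification_jump wL t ->
  exists2 g, g \in GalLK L & g wL != wL /\ valu (lint L) wL (g wL - wL) = t + 1.
Proof.
move=> /zint_dvr dwK /lint_dvr dwL degLK tot [_ Gt].
have [wLO w0 _ _ _] := dwL.
have GP i g : lower_ramification_group wL i g <->
    g \in GalLK L /\ forall x, x \in lint L -> vge (lint L) wL (i + 1) (g x - x).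
  split=> -[gG h]; split=> // x.
    move=> xO; have [|y yO ->] := h x; first by rewrite OLE.
    by rewrite (vgeE dwL) mulrC mulKf ?expfz_neq0 // -OLE.
  rewrite OLE => /h/(vge_wP dwL)[y yO ->]; exists y => //; by rewrite OLE.
have Gle g i : lower_ramification_group wL (i + 1) g -> lower_ramification_group wL i g.
  move=> /GP[gG h]; apply/GP; split=> // x /h; apply: vge_trans.
  by rewrite lerD2r lerDl.
have [g [/GP[gG gt] gt']] : exists g, lower_ramification_group wL t g /\
    ~ lower_ramification_group wL (t + 1) g.
  apply: contrapT => no; apply: Gt; apply/seteqP; split=> g; last exact: Gle.
  by move=> gt; apply: contrapT => gt'; apply: no; exists g.
exists g => //; have vg := gt wL wLO.
have nvg : ~ vge (lint L) wL (t + 1 + 1) (g wL - wL).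
  move=> vg'; apply: gt'; apply/GP; split=> // x.
  have [a ->] := expand_ex dwK dwL degLK tot x.
  move/(expand_lint dwK dwL tot) => aO.
  rewrite rmorph_sum -sumrB; apply: (vge_sum dwL) => i _.
  rewrite /=; have -> : g (a i *: wL ^+ i) = a i *: (g wL) ^+ i by rewrite linearZ /= rmorphXn.
  rewrite -scalerBr subrXX [(g wL - wL) * _]mulrC -[a i *: _]mulr_algl mulrA.
  apply: (vgeMl dwL) vg'; apply: rpredM; first by rewrite lint_alg.
  by apply: rpred_sum => j _; rewrite rpredM ?rpredX ?lint_gal.
have d0 : g wL - wL != 0 by apply/eqP => d0; apply: nvg; rewrite d0 vge0.
split; first by rewrite -subr_eq0.
apply/eqP; rewrite eq_le; move: vg; rewrite /vge (negPf d0) /= => ->; rewrite andbT.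
by rewrite -ltzD1 ltNge; apply/negP => le; apply: nvg; rewrite /vge le orbT.
Qed.

Theorem proposition6p3 (R : realType) (p : nat) (p_pr : prime p)
    (K : fieldExtType (padic p_pr)) (L : splittingFieldType K)
    (galLK : galois 1 {:L}) (degLK : \dim {:L} = p) (ramLK : ramified L)
    (wL : L) (wL_unif : uniformiser (OL L) wL)
    (t : int) (t_jump : ramification_jump wL t) (pt : (p %| t)%Z) :
  [/\ exists2 wK : K, uniformiser (OK K) wK &
        exists2 r : L, r ^+ p = wK%:A & <<1; r>>%VS = {:L}%VS,
      minimal_index L R = (p%:R `^ ((abs_degree L)%:R / 2))%:E
    & forall (wK : K) (r : L), uniformiser (OK K) wK -> r ^+ p = wK%:A ->
        <<1; r>>%VS = {:L}%VS ->
      forall c : 'I_p -> K, (forall i, OK K (c i)) ->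
        add_index R (OL L) (galois_orbit_module (\sum_(i < p) c i *: r ^+ i))
          = minimal_index L R
        <-> forall i, unit_of (OK K) (c i)].
Proof.
have dwL := lint_dvr wL_unif.
have [e e_gt1 [wK [w' [wK_unif w'_unif ram]]]] := ramLK.
have dwK := zint_dvr wK_unif; have dw' := lint_dvr w'_unif.
(* [ramLK] measures e with its own uniformiser w', so the valuation is first transferred to wL. *)
have tot : valu (lint L) wL wK%:A = p.
  apply: (ramification_eq_degree dwK dwL galLK degLK).
  rewrite -(valu_indep dwL _ dw') (val_eq dw' (n := e)) ?ltz_nat //.
  by rewrite -exprnP; apply/unit_OLE.
have [g gG [gwL vg]] := jump_element wK_unif wL_unif degLK tot t_jump.
have g1 : g != 1%g by apply: contraNneq gwL => ->; rewrite gal_id.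
have g_order := iter_gal_order galLK degLK gG g1.
have g_fixed := gal_fixed_alg galLK degLK gG g1.
(* The only negative candidate is -1, which p does not divide. *)
have t_ge0 : 0 <= t.
  have [t1 _] := t_jump; rewrite leNgt; apply/negP => t_lt0.
  have tE : t = -1 by apply/eqP; rewrite eq_le t1 andbT -ltzD1 addNr.
  move: pt; rewrite tE dvdzE /= dvdn1 => /eqP p1.
  by have := prime_gt1 p_pr; rewrite p1.
have [z zp z1] := zeta_exists wK_unif wL_unif degLK tot g_order t_ge0 pt gwL vg.
have z_prim := prime_primitive_root p_pr zp z1.
(* The criterion concerns every Kummer generator r, not just a constructed one. Always g r / r is a
   p-th root of unity, hence a power of z, and it is not 1 because v(r) = 1 is prime to p. *)
have main (b : K) (r : L) : uniformiser (OK K) b -> r ^+ p = b%:A ->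
    [/\ uniformiser (OL L) r, valu (lint L) r b%:A = p &
      exists y : K, [/\ y ^+ p = 1, y != 1 & g r = y *: r]].
  move=> b_unif rp; have db := zint_dvr b_unif; have [_ b0 _ _ _] := db.
  have r0 : r != 0.
    have : b%:A != 0 :> L by rewrite -in_algE fmorph_eq0.
    by rewrite -rp expf_eq0 prime_gt0.
  have vr : valu (lint L) wL r = 1.
    have p0 : p%:Z != 0 by rewrite eqz_nat -lt0n prime_gt0.
    apply: (mulfI p0); rewrite -(valX dwL) // rp (val_algp dwK dwL tot).
    by rewrite (valu_unif dwK db).
  have dr := dvr_val1 dwL vr r0; split; first exact: dvr_OL.
    by rewrite (valu_indep dwL _ dr) (val_algp dwK dwL tot) (valu_unif dwK db) mulr1.
  have z_primL : p.-primitive_root (z%:A : L).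
    by rewrite -in_algE fmorph_primitive_root.
  have : (g r / r) ^+ p = 1.
    rewrite exprMn exprVn -rmorphXn /= rp linearZ rmorph1 /= divff //.
    by rewrite -in_algE fmorph_eq0.
  case/(prim_rootP z_primL) => i uE; exists (z ^+ i).
  have gr : g r = z ^+ i *: r.
    by rewrite -[LHS](divfK r0) uE -in_algE -rmorphXn /= mulr_algl.
  split=> //; first by rewrite exprAC zp expr1n.
  have [] := v_del wK_unif wL_unif degLK tot g_order t_ge0 gwL vg r0.
    by rewrite vr dvdz1 /= neq_ltn prime_gt1 ?orbT.
  by rewrite subr_eq0 => grr _; apply: contraNneq grr => zi; rewrite gr zi scale1r.
have orbE := galois_orbitE galLK degLK gG g1.
have [b [r [db dr rp]]] :=
  kummer_generator wK_unif wL_unif degLK tot g_order t_ge0 pt gwL vg g_fixed.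
have b_unif : uniformiser (OK K) b := dvr_uniformiser db.
have [r_unif totr [y [yp y1 gr]]] := main b r b_unif rp.
have minE := minimal_indexE R b_unif r_unif degLK totr yp y1 gr orbE.
split=> //.
  exists b => //; exists r => //; apply/vspaceP => x; rewrite memvf.
  have [a ->] := expand_ex db dr degLK totr x.
  by apply: rpred_sum => i _; apply/memvZ/rpredX/memv_adjoin.
(* The value in [minE] was found with the pair b, r but does not depend on it, so it can be compared
   with indices in the basis of powers of r'. *)
move=> {b_unif}b' r' b'_unif rp' _ c cO; rewrite minE.
have [r'_unif totr' [y' [yp' y1' gr']]] := main b' r' b'_unif rp'.
have cO' i : c i \in zint K by rewrite -ring_of_integersE; exact: cO.
rewrite (index_of_eq R b'_unif r'_unif degLK totr' yp' y1' gr' orbE cO').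
by split=> h i; apply/unit_ofE; apply: h.
Qed.
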